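(* Let $X_1,X_2,U$ be real Hilbert spaces, $X=X_1\oplus X_2$, and let $B:U\to X$ be linear and bounded. Let $\mathcal M_1:X_1\to X_1$ be a (possibly nonlinear) bounded m-accretive operator and let $\mathcal M_2:X_1\supset D(\mathcal M_2)\to X_2$ be linear, closed and densely defined. Define $D(M)=D(\mathcal M_2)\oplus D(\mathcal M_2^* )$ and $$M(x_1,x_2)=\begin{bmatrix}\mathcal M_1(x_1)-\mathcal M_2^*x_2\\ \mathcal M_2x_1\end{bmatrix},\qquad (x_1,x_2)\in D(M).$$ Consider the system $$\tfrac{\mathrm d}{\mathrm dt}x(t)=-M(x(t))+Bu(t),\quad x(0)=x^0 .\qquad(\ast)$$ Assume: (i) $M$ is m-accretive and invertible (bijective from $D(M)$ onto $X$); (ii) $\mathcal M_1$ is strongly accretive at $\overline x_1\in X_1$ and Fréchet differentiable. Then the following hold. (a) For any $\overline u\in U$ there is a unique steady state of $(\ast)$ (i.e. a unique $\overline x\in D(M)$ with $-M(\overline x)+B\overline u=0$), given by $\overline x=M^{-1}(B\overline u)$. For the remaining statements consider a constant input $u(t)\equiv\overline u\in U$ and the steady state $\overline x=M^{-1}(B\overline u)=(\overline x_1,\overline x_2)$, whose first component is the point $\overline x_1$ in (ii). (b) The steady state $\overline x$ is locally exponentially stable in the following sense: there exist $\delta>0$ and $c>0$ such that for all $x^0=(x_1^0,x_2^0)\in D(M)$ with $\|x_2^0-\overline x_2\|<\delta$, the strong solution of $(\ast)$ fulfills $\|x(t)-\overline x\|\le\alpha e^{-ct}$ for all $t\ge0$,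 with $\alpha>0$ depending only on $\|x^0\|$. (c) The steady state $\overline x$ is globally asymptotically stable, i.e. for all initial values $x^0\in D(M)$ the strong solution satisfies $x(t)=(x_1(t),x_2(t))\to(\overline x_1,\overline x_2)=\overline x$ as $t\to\infty$. (d) If $\mathcal M_1$ is linear, then the exponential stability from (b) holds globally, i.e. for all $\delta>0$.
   Context: An operator $M:X\supseteq D(M)\to X$ on a real Hilbert space is accretive if $\langle M(x)-M(y),x-y\rangle\ge0$ for all $x,y\in D(M)$, and m-accretive if in addition $\operatorname{ran}(\lambda I+M)=X$ for some (equivalently all) $\lambda>0$. It is strongly accretive at $\overline x\in D(M)$ if there is $c_M>0$ with $\langle x-\overline x,M(x)-M(\overline x)\rangle\ge c_M\|x-\overline x\|^2$ for all $x$ in its domain. A bounded nonlinear operator is one mapping bounded sets to bounded sets. A strong solution on $[0,t_f]$ is a function $x\in C([0,t_f],X)\cap W^{1,1}((0,t_f],X)$ that is differentiable almost everywhere, attains the initial value, and satisfies the differential equation for almost every $t\in(0,t_f)$; a strong solution on $[0,\infty)$ is one on every finite interval $[0,t_f]$. Known fact: for m-accretive $M$, a constant input and $x^0\in D(M)$, there is a unique strong solution. *)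

(* Defs.v *)
From HB Require Import structures.
From mathcomp Require Import all_boot all_order all_algebra.
From mathcomp Require Import all_classical all_reals all_analysis.
From mathcomp Require Import ring lra.

Set Implicit Arguments.
Unset Strict Implicit.
Unset Printing Implicit Defensive.

Import Order.TTheory GRing.Theory Num.Theory.
Import numFieldNormedType.Exports.

Local Open Scope classical_set_scope.
Local Open Scope ring_scope.

HB.mixin Record isHilbert (R : realType) H & CompleteNormedModule R H := {
  dot : H -> H -> R ;
  dotC : forall x y : H, dot x y = dot y x ;
  dotDl : forall x y z : H, dot (x + y) z = dot x z + dot y z ;
  dotZl : forall (a : R) (x y : H), dot (a *: x) y = a * dot x y ;
  dot_norm : forall x : H, dot x x = `|x| ^+ 2
}.

#[short(type="hilbertType")]
HB.structure Definition Hilbert (R : realType) :=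
  {H of CompleteNormedModule R H & isHilbert R H}.

Section dot_theory.
Variables (R : realType) (H : hilbertType R).
Implicit Types x y z : H.

Lemma dotDr x y z : dot x (y + z) = dot x y + dot x z.
Proof. by rewrite dotC dotDl !(dotC x). Qed.

Lemma dotZr (a : R) x y : dot x (a *: y) = a * dot x y.
Proof. by rewrite dotC dotZl (dotC x). Qed.

Lemma dot_normE x : `|x| = Num.sqrt (dot x x).
Proof. by rewrite dot_norm sqrtr_sqr normr_id. Qed.

Lemma dot0l x : dot 0 x = 0.
Proof. by rewrite -(scale0r 0) dotZl mul0r. Qed.

Lemma dot_CauchySchwarz x y : dot x y <= `|x| * `|y|.
Proof.
have [->|y0] := eqVneq y 0; first by rewrite dotC dot0l normr0 mulr0.
have ny : 0 < `|y| by rewrite normr_gt0.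
have [->|x0] := eqVneq x 0; first by rewrite dot0l normr0 mul0r.
have nx : 0 < `|x| by rewrite normr_gt0.
have : 0 <= dot (`|y| *: x - `|x| *: y) (`|y| *: x - `|x| *: y).
  by rewrite dot_norm sqr_ge0.
rewrite -scaleNr dotDl !dotDr !dotZl !dotZr !dot_norm (dotC y x) => h.
have {}h : 0 <= (`|x| * `|y|) * (`|x| * `|y| - dot x y) by nra.
by rewrite -subr_ge0; rewrite pmulr_rge0 ?mulr_gt0 in h.
Qed.

End dot_theory.

(* The canonical norm of the product type [X1 * X2] is the maximum norm, hence
   the alias, which carries the Hilbert norm. *)
Definition hsum (X1 X2 : Type) : Type := (X1 * X2)%type.

Section hsum.
Variables (R : realType) (X1 X2 : hilbertType R).

HB.instance Definition _ := GRing.Lmodule.copy (hsum X1 X2) (X1 * X2)%type.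

Definition hsum_dot (x y : hsum X1 X2) : R := dot x.1 y.1 + dot x.2 y.2.
Definition hsum_norm (x : hsum X1 X2) : R := Num.sqrt (hsum_dot x x).

Let hsum_dot_ge0 (x : hsum X1 X2) : 0 <= hsum_dot x x.
Proof. by rewrite /hsum_dot !dot_norm addr_ge0 ?sqr_ge0. Qed.

Let hsum_norm_sqr (x : hsum X1 X2) : hsum_norm x ^+ 2 = hsum_dot x x.
Proof. by rewrite sqr_sqrtr. Qed.

Let hsum_norm_ge0 (x : hsum X1 X2) : 0 <= hsum_norm x.
Proof. exact: sqrtr_ge0. Qed.

Let hsum_CauchySchwarz (x y : hsum X1 X2) :
  hsum_dot x y <= hsum_norm x * hsum_norm y.
Proof.
rewrite -sqrtrM// (le_trans (ler_norm _))// -sqrtr_sqr ler_wsqrtr//.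
rewrite -!hsum_norm_sqr /hsum_norm !sqr_sqrtr// /hsum_dot !dot_norm.
have cs1 : `|dot x.1 y.1| <= `|x.1| * `|y.1|.
  rewrite ler_norml dot_CauchySchwarz andbT lerNl.
  by rewrite -mulN1r -dotZl scaleN1r (le_trans (dot_CauchySchwarz _ _))// normrN.
have cs2 : `|dot x.2 y.2| <= `|x.2| * `|y.2|.
  rewrite ler_norml dot_CauchySchwarz andbT lerNl.
  by rewrite -mulN1r -dotZl scaleN1r (le_trans (dot_CauchySchwarz _ _))// normrN.
rewrite -[leLHS]real_normK ?num_real//.
apply: (@le_trans _ _ ((`|x.1| * `|y.1| + `|x.2| * `|y.2|) ^+ 2)).
  rewrite ler_sqr ?nnegrE ?normr_ge0 ?addr_ge0 ?mulr_ge0//.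
  by rewrite (le_trans (ler_normD _ _))// lerD.
have := sqr_ge0 (`|x.1| * `|y.2| - `|x.2| * `|y.1|).
nra.
Qed.

Let hsum_ler_normD (x y : hsum X1 X2) :
  hsum_norm (x + y) <= hsum_norm x + hsum_norm y.
Proof.
rewrite -ler_sqr ?nnegrE ?addr_ge0// sqrrD !hsum_norm_sqr.
have -> : hsum_dot (x + y) (x + y) =
    hsum_dot x x + hsum_dot x y *+ 2 + hsum_dot y y.
  rewrite /hsum_dot /= !dotDl !dotDr (dotC y.1) (dotC y.2).
  ring.
by rewrite lerD2r lerD2l lerMn2r hsum_CauchySchwarz.
Qed.

Let hsum_normrZ (a : R) (x : hsum X1 X2) :
  hsum_norm (a *: x) = `|a| * hsum_norm x.
Proof.
rewrite -sqrtr_sqr -sqrtrM ?sqr_ge0//; congr Num.sqrt.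
rewrite /hsum_dot /= !dotZl !dotZr; ring.
Qed.

Let hsum_normr0_eq0 (x : hsum X1 X2) : hsum_norm x = 0 -> x = 0.
Proof.
move=> h; have := hsum_norm_sqr x; rewrite h expr0n/= /hsum_dot !dot_norm.
move=> /esym/eqP; rewrite paddr_eq0 ?sqr_ge0// !sqrf_eq0 !normr_eq0.
by case: x {h} => x1 x2 /= /andP[/eqP-> /eqP->].
Qed.

HB.instance Definition _ := @Lmodule_isNormed.Build R (hsum X1 X2)
  hsum_norm hsum_ler_normD hsum_normrZ hsum_normr0_eq0.

Lemma hsum_normE (x : hsum X1 X2) :
  `|x| = Num.sqrt (`|x.1| ^+ 2 + `|x.2| ^+ 2).
Proof. by rewrite -!dot_norm. Qed.

Let hsum_complete (F : set_system (hsum X1 X2)) :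
  ProperFilter F -> cauchy F -> cvg F.
Proof.
move=> FF /cauchyP Fc.
have fst_le (x : hsum X1 X2) : `|x.1| <= `|x|.
  rewrite hsum_normE -[leLHS](ger0_norm (normr_ge0 _)) -sqrtr_sqr.
  by rewrite ler_wsqrtr// lerDl sqr_ge0.
have snd_le (x : hsum X1 X2) : `|x.2| <= `|x|.
  rewrite hsum_normE -[leLHS](ger0_norm (normr_ge0 _)) -sqrtr_sqr.
  by rewrite ler_wsqrtr// lerDr sqr_ge0.
have /cauchy_cvgP/cvg_ex[a Fa] : cauchy ((fun x : hsum X1 X2 => x.1) @ F).
  apply/cauchyP => e e0; have [x Fx] := Fc e e0; exists x.1.
  apply: (@filterS _ F _ (ball x e)) Fx => y; rewrite -!ball_normE /=.
  exact: (le_lt_trans (fst_le (x - y))).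
have /cauchy_cvgP/cvg_ex[b Fb] : cauchy ((fun x : hsum X1 X2 => x.2) @ F).
  apply/cauchyP => e e0; have [x Fx] := Fc e e0; exists x.2.
  apply: (@filterS _ F _ (ball x e)) Fx => y; rewrite -!ball_normE /=.
  exact: (le_lt_trans (snd_le (x - y))).
apply/cvg_ex; exists ((a, b) : hsum X1 X2).
apply/cvgrPdist_lt => e e0; near=> x.
have h1 : `|a - x.1| < e / 2.
  by near: x; move/cvgrPdist_lt: Fa; apply; rewrite divr_gt0.
have h2 : `|b - x.2| < e / 2.
  by near: x; move/cvgrPdist_lt: Fb; apply; rewrite divr_gt0.
rewrite hsum_normE /= -(gtr0_norm e0) -sqrtr_sqr ltr_sqrt ?exprn_gt0//.
have := normr_ge0 (a - x.1); have := normr_ge0 (b - x.2).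
nra.
Unshelve. all: by end_near. Qed.

HB.instance Definition _ :=
  Uniform_isComplete.Build (hsum X1 X2) hsum_complete.

Let hsum_dotC (x y : hsum X1 X2) : hsum_dot x y = hsum_dot y x.
Proof. by rewrite /hsum_dot dotC (dotC x.2). Qed.

Let hsum_dotDl (x y z : hsum X1 X2) :
  hsum_dot (x + y) z = hsum_dot x z + hsum_dot y z.
Proof. by rewrite /hsum_dot /= !dotDl addrACA. Qed.

Let hsum_dotZl (a : R) (x y : hsum X1 X2) :
  hsum_dot (a *: x) y = a * hsum_dot x y.
Proof. by rewrite /hsum_dot /= !dotZl mulrDr. Qed.

Let hsum_dot_norm (x : hsum X1 X2) : hsum_dot x x = `|x| ^+ 2.
Proof. by rewrite -hsum_norm_sqr. Qed.

HB.instance Definition _ := @isHilbert.Build R (hsum X1 X2)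
  hsum_dot hsum_dotC hsum_dotDl hsum_dotZl hsum_dot_norm.

Lemma hsum_dotE (x y : hsum X1 X2) : dot x y = dot x.1 y.1 + dot x.2 y.2.
Proof. by []. Qed.

End hsum.

(* [papp] is total; its values outside of [pdom] are irrelevant, and every
   notion below only depends on its restriction to [pdom]. *)
Record pop (X Y : Type) := Pop { pdom : set X ; papp :> X -> Y }.

Definition total_op (X Y : Type) (f : X -> Y) : pop X Y := Pop setT f.

Section operators.
Variable R : realType.

Definition accretive (X : hilbertType R) (M : pop X X) : Prop :=
  forall x y, pdom M x -> pdom M y -> 0 <= dot (M x - M y) (x - y).

Definition m_accretive (X : hilbertType R) (M : pop X X) : Prop :=
  accretive M /\
  exists2 l : R, 0 < l &
    forall y, exists2 x, pdom M x & l *: x + M x = y.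

Definition strongly_accretive_at (X : hilbertType R) (M : pop X X) (xb : X)
    : Prop :=
  pdom M xb /\
  exists2 c : R, 0 < c &
    forall x, pdom M x -> c * `|x - xb| ^+ 2 <= dot (x - xb) (M x - M xb).

Definition bounded_op (X Y : normedModType R) (f : X -> Y) : Prop :=
  forall A : set X, bounded_set A -> bounded_set (f @` A).

Definition invertible (X Y : Type) (M : pop X Y) : Prop :=
  set_bij (pdom M) setT M.

Definition op_inv (X : pointedType) (Y : Type) (M : pop X Y) : Y -> X :=
  pinv (pdom M) M.

Definition linear_op (X Y : lmodType R) (A : pop X Y) : Prop :=
  pdom A 0 /\
  forall (a : R) x y, pdom A x -> pdom A y ->
    pdom A (a *: x + y) /\ A (a *: x + y) = a *: A x + A y.

Definition closed_op (X Y : normedModType R) (A : pop X Y) : Prop :=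
  closed [set p : X * Y | pdom A p.1 /\ A p.1 = p.2].

Definition densely_defined (X Y : normedModType R) (A : pop X Y) : Prop :=
  dense (pdom A).

Section adjoint.
Variables (X Y : hilbertType R) (A : pop X Y).

Definition adjoint_rel (y : Y) (z : X) : Prop :=
  forall x, pdom A x -> dot (A x) y = dot x z.

(* For densely defined [A] the vector selected by [get] is unique. *)
Definition adjoint : pop Y X :=
  Pop [set y | exists z, adjoint_rel y z] (fun y => get (adjoint_rel y)).

End adjoint.

Definition block_op (X1 X2 : hilbertType R) (M1 : X1 -> X1) (M2 : pop X1 X2)
    : pop (hsum X1 X2) (hsum X1 X2) :=
  Pop [set x | pdom M2 x.1 /\ pdom (adjoint M2) x.2]
      (fun x => (M1 x.1 - adjoint M2 x.2, M2 x.1)).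

End operators.

Section bochner.
Variables (R : realType) (X : normedModType R).
Local Notation mu := (@lebesgue_measure R).

Record simple_fun := SimpleFun {
  sf_card : nat ;
  sf_set : 'I_sf_card -> set R ;
  sf_val : 'I_sf_card -> X ;
  sf_measurable : forall i, measurable (sf_set i)
}.

Definition sf_app (s : simple_fun) (t : R) : X :=
  \sum_i \1_(@sf_set s i) t *: @sf_val s i.

Definition sf_integral (a b : R) (s : simple_fun) : X :=
  \sum_i fine (mu (@sf_set s i `&` `]a, b[)) *: @sf_val s i.

Definition is_bochner_integral (a b : R) (f : R -> X) (I : X) : Prop :=
  exists s : nat -> simple_fun,
    [/\ {ae mu, forall t, t \in `]a, b[ ->
           sf_app (s n) t @[n --> \oo] --> f t},
        (\int[mu]_(t in `]a, b[) `|f t - sf_app (s n) t|%:E)%E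
          @[n --> \oo] --> (0 : \bar R)
      & sf_integral a b (s n) @[n --> \oo] --> I].

Definition bochner_integrable (a b : R) (f : R -> X) : Prop :=
  exists I, is_bochner_integral a b f I.

(* Compactly supported C^1 functions on ]a, b[; testing against these or
   against compactly supported smooth functions defines the same weak
   derivative. *)
Definition test_function (a b : R) (phi : R -> R) : Prop :=
  [/\ forall t, derivable phi t 1,
      continuous (derive1 phi)
    & exists c d, [/\ a < c, d < b & forall t, t \notin `[c, d] -> phi t = 0]].

Definition weak_derivative (a b : R) (f g : R -> X) : Prop :=
  forall phi, test_function a b phi ->
    exists2 I, is_bochner_integral a b (fun t => derive1 phi t *: f t) I
             & is_bochner_integral a b (fun t => phi t *: g t) (- I).

Definition W11 (a b : R) (f : R -> X) : Prop :=
  bochner_integrable a b f /\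
  exists2 g, bochner_integrable a b g & weak_derivative a b f g.

End bochner.

Section system.
Variables (R : realType) (X U : hilbertType R).
Variables (M : pop X X) (B : U -> X).
Local Notation mu := (@lebesgue_measure R).

Definition steady_state (ubar : U) (xbar : X) : Prop :=
  pdom M xbar /\ - M xbar + B ubar = 0.

(* Only the restriction of [x] to [0, tf] matters. *)
Definition strong_solution_on (u : R -> U) (x0 : X) (tf : R) (x : R -> X)
    : Prop :=
  [/\ {within `[0, tf], continuous x},
      W11 0 tf x,
      {ae mu, forall t, t \in `]0, tf[ -> derivable x t 1},
      x 0 = x0
    & {ae mu, forall t, t \in `]0, tf[ ->
        pdom M (x t) /\ derive1 x t = - M (x t) + B (u t)}].

Definition strong_solution (u : R -> U) (x0 : X) (x : R -> X) : Prop :=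
  forall tf, 0 < tf -> strong_solution_on u x0 tf x.

End system.

(* [alpha] is a function of the norm of the initial value: the constant in the
   decay estimate depends on the initial value through its norm only. *)
Definition exp_decay (R : realType) (X1 X2 U : hilbertType R)
    (M : pop (hsum X1 X2) (hsum X1 X2)) (B : U -> hsum X1 X2) (ubar : U)
    (xbar : hsum X1 X2) (delta c : R) (alpha : R -> R) : Prop :=
  forall x0, pdom M x0 -> `|x0.2 - xbar.2| < delta ->
  forall x, strong_solution M B (fun=> ubar) x0 x ->
  forall t, 0 <= t -> `|x t - xbar| <= alpha `|x0| * expR (- c * t).

(* Main.v *)
(* The exponential estimate holds for all initial values, with a rate independent
   of them; (b), (c) and (d) follow at once. Let e = x - xbar. By skew-symmetry
   of the off-diagonal part of M, |e|^2 / 2 decays at least at the rate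
   c |e.1|^2; to damp e.2 as well, one uses the Lyapunov function
   V = |e|^2 / 2 - eps <e.1, N e.2>. Here N y = p is read off the orthogonal
   decomposition (0, y) = (p, M2 p) + (- M2' q, q) along the graph of M2, where
   M2' is the adjoint of M2; N is bounded, N M2 is bounded, and M2 N is coercive
   because M2 is onto, by the uniform boundedness principle. Since M1 is bounded
   and differentiable at xbar.1, |M1 x - M1 xbar.1| <= L |x - xbar.1| on balls,
   so V decays exponentially at a rate depending on |e 0|; once |e| <= 1 the
   rate is that of the unit ball.
   A strong solution is only weakly differentiable: testing the weak derivative
   g against C^1 splines gives |x t - x s| <= \int_s^t |g|, and a real function
   with such a modulus and a nonpositive derivative almost everywhere is
   nonincreasing. *)
Require Import Defs.
From mathcomp Require Import all_boot all_order all_algebra.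
From mathcomp Require Import all_classical all_reals all_analysis.
From mathcomp Require Import measurable_realfun.
From mathcomp Require Import ring lra.

Set Implicit Arguments.
Unset Strict Implicit.
Unset Printing Implicit Defensive.

Import Order.TTheory GRing.Theory Num.Theory.
Import numFieldNormedType.Exports.

Local Open Scope classical_set_scope.
Local Open Scope ring_scope.

(** * Inner products and bounded symmetric forms *)

Section dot_extra.
Variables (R : realType) (H : hilbertType R).
Implicit Types x y z : H.

Lemma dotNl x y : dot (- x) y = - dot x y.
Proof. by rewrite -scaleN1r dotZl mulN1r. Qed.

Lemma dotNr x y : dot x (- y) = - dot x y.
Proof. by rewrite dotC dotNl dotC. Qed.

Lemma dotBl x y z : dot (x - y) z = dot x z - dot y z.
Proof. by rewrite dotDl dotNl. Qed.

Lemma dotBr x y z : dot x (y - z) = dot x y - dot x z.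
Proof. by rewrite dotDr dotNr. Qed.

Lemma dot0r x : dot x 0 = 0.
Proof. by rewrite dotC dot0l. Qed.

Lemma dot_abs_le x y : `|dot x y| <= `|x| * `|y|.
Proof.
rewrite ler_norml dot_CauchySchwarz andbT lerNl -dotNl.
by rewrite (le_trans (dot_CauchySchwarz _ _))// normrN.
Qed.

Lemma dot_suml (I : finType) (F : I -> H) y :
  dot (\sum_i F i) y = \sum_i dot (F i) y.
Proof.
by elim/big_ind2: _ => [|? ? ? ? <- <-|//]; rewrite ?dot0l ?dotDl.
Qed.

End dot_extra.

Section symmetric_forms.
Variables (R : realType) (H : hilbertType R).
Implicit Types (b : H -> H -> R) (u v w x : H).

(** The inner product and the Lyapunov form are both of this kind, so that one decay argument along
    solutions serves for both. *)
Definition bounded_sym_form b (C : R) : Prop :=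
  [/\ forall u v, b u v = b v u, forall u v w, b (u + v) w = b u w + b v w,
      forall (a : R) u v, b (a *: u) v = a * b u v &
      forall u v, `|b u v| <= C * (`|u| * `|v|)].

Variables (b : H -> H -> R) (C : R) (bP : bounded_sym_form b C).

Let bC u v : b u v = b v u. Proof. by case: bP. Qed.
Let bDl u v w : b (u + v) w = b u w + b v w. Proof. by case: bP. Qed.
Let bDr u v w : b w (u + v) = b w u + b w v. Proof. by rewrite bC bDl !(bC w). Qed.
Let bZl (a : R) u v : b (a *: u) v = a * b u v. Proof. by case: bP. Qed.
Let bNl u v : b (- u) v = - b u v. Proof. by rewrite -scaleN1r bZl mulN1r. Qed.
Let bNr u v : b u (- v) = - b u v. Proof. by rewrite bC bNl bC. Qed.
Let b_le u v : `|b u v| <= C * (`|u| * `|v|). Proof. by case: bP. Qed.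

(** Expand b (f, g) - b (x, y) = b (f - x, g - y) + b (f - x, y) + b (x, g - y); each term is
    bounded by a product of norms that tends to 0. *)
Lemma cvg_sym_form (T : Type) (F : set_system T) {FF : Filter F} (f g : T -> H) x y :
  f @ F --> x -> g @ F --> y -> b (f t) (g t) @[t --> F] --> b x y.
Proof.
move=> fx gy.
have -> : (fun t => b (f t) (g t)) = (fun t =>
    b (f t - x) (g t - y) + (b (f t - x) y + b x (g t - y)) + b x y).
  by apply/funext => t; rewrite !bDl !bDr !bNl !bNr; ring.
rewrite -[X in _ --> X]add0r; apply: cvgD; last exact: cvg_cst.
have fx0 : `|f t - x| @[t --> F] --> 0.
  by rewrite -(normr0 H); apply: cvg_norm; rewrite -(subrr x); exact: cvgB fx (cvg_cst _).
have gy0 : `|g t - y| @[t --> F] --> 0.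
  by rewrite -(normr0 H); apply: cvg_norm; rewrite -(subrr y); exact: cvgB gy (cvg_cst _).
apply: norm_cvg0.
apply: (@squeeze_cvgr _ _ _ _ (fun=> 0) (fun t => C * (`|f t - x| * `|g t - y|) +
   (C * (`|f t - x| * `|y|) + C * (`|x| * `|g t - y|)))); last 2 first.
- exact: cvg_cst.
- rewrite -[X in _ --> X](_ : C * (0 * 0) + (C * (0 * `|y|) + C * (`|x| * 0)) = 0);
    last by ring.
  apply: cvgD; first by apply: cvgM; [exact: cvg_cst|exact: cvgM].
  apply: cvgD; (apply: cvgM; first exact: cvg_cst);
    by apply: cvgM => //; exact: cvg_cst.
near=> t; rewrite normr_ge0/= (le_trans (ler_normD _ _))// lerD ?b_le//.
by rewrite (le_trans (ler_normD _ _))// lerD ?b_le.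
Unshelve. all: by end_near. Qed.

(** By symmetry b (p, p) - b (q, q) = b (p - q, p + q), so the difference quotient is [b] applied to
    the quotient of [x] and to a sum that tends to 2 (x t - xb). *)
Lemma is_derive_sym_form (x : R -> H) (t : R) xb : derivable x t 1 ->
  is_derive t (1:R) (fun u : R => b (x u - xb) (x u - xb))
    (2 * b (derive1 x t) (x t - xb)).
Proof.
move=> dx.
have dxE : u^-1 *: (x (u *: 1 + t) - x t) @[u --> (0:R)^'] --> derive1 x t.
  by rewrite derive1E; exact: dx.
have xc : x (u *: 1 + t) @[u --> (0:R)^'] --> x t.
  have : u *: (u^-1 *: (x (u *: 1 + t) - x t)) + x t @[u --> (0:R)^'] -->
      0 *: derive1 x t + x t.
    apply: cvgD; last exact: cvg_cst.
    by apply: cvgZ => // A A0; exact: nbhs_dnbhs.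
  rewrite scale0r add0r; apply: cvg_trans; apply: near_eq_cvg.
  near=> u; rewrite scalerA divff ?scale1r ?subrK//.
  by near: u; exact: nbhs_dnbhs_neq.
pose f (u : R) := b (x u - xb) (x u - xb).
have fd : u^-1 *: ((f \o shift t) (u *: 1) - f t) @[u --> (0:R)^'] -->
    2 * b (derive1 x t) (x t - xb).
  have -> : (fun u : R => u^-1 *: ((f \o shift t) (u *: 1) - f t)) = (fun u : R =>
      b (u^-1 *: (x (u *: 1 + t) - x t)) ((x (u *: 1 + t) - xb) + (x t - xb))).
    apply/funext => u; rewrite bZl; congr (_ * _).
    rewrite /f /= !bDl !bDr !bNl !bNr (bC (x t) (x (u *: 1 + t))).
    rewrite (bC xb (x (u *: 1 + t))) (bC xb (x t)); ring.
  have -> : 2 * b (derive1 x t) (x t - xb) = b (derive1 x t) ((x t - xb) + (x t - xb)).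
    by rewrite [RHS]bDr; ring.
  apply: cvg_sym_form => //; apply: cvgD; last exact: cvg_cst.
  by apply: cvgB => //; exact: cvg_cst.
by apply: DeriveDef; [apply/cvg_ex; eexists; exact: fd|apply/cvg_lim].
Unshelve. all: by end_near. Qed.

Lemma sym_form_diff_le u v (E : R) : 0 <= C -> `|u| <= E -> `|v| <= E ->
  `|b u u - b v v| <= C * (2 * E) * `|u - v|.
Proof.
move=> C0 uE vE.
have -> : b u u - b v v = b (u - v) (u + v).
  by rewrite !bDl !bDr !bNl (bC v u); ring.
apply: le_trans (b_le _ _) _; rewrite -mulrA ler_wpM2l// mulrC ler_wpM2r//.
by apply: le_trans (ler_normD _ _) _; rewrite mulr2n mulrDl mul1r lerD.
Qed.

End symmetric_forms.

(** Factor out [expR (k * s)] and use 1 - u <= expR (- u) with u = k (s - r). *)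
Lemma expR_scale_lipschitz (R : realType) (k r s : R) : 0 <= k -> r <= s ->
  `|expR (k * s) - expR (k * r)| <= k * expR (k * s) * (s - r).
Proof.
move=> k0 rs; rewrite ger0_norm; last by rewrite subr_ge0 ler_expR ler_wpM2l.
have -> : expR (k * r) = expR (k * s) * expR (- (k * (s - r))).
  by rewrite -expRD; congr expR; ring.
have := expR_ge1Dx (- (k * (s - r))); have := expR_gt0 (k * s); nra.
Qed.

Section dot_form.
Variables (R : realType) (H : hilbertType R).

Lemma dot_bounded_sym_form : bounded_sym_form (@dot R H) 1.
Proof.
split; [exact: dotC|exact: dotDl|exact: dotZl|].
by move=> u v; rewrite mul1r dot_abs_le.
Qed.

Lemma cvg_dot (T : Type) (F : set_system T) {FF : Filter F} (f g : T -> H) x y :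
  f @ F --> x -> g @ F --> y -> dot (f t) (g t) @[t --> F] --> dot x y.
Proof. by move=> fx gy; apply: (cvg_sym_form dot_bounded_sym_form). Qed.

End dot_form.

(** * Bochner integrals *)

Section simple_functions.
Variables (R : realType) (H : hilbertType R).
Local Notation mu := (@lebesgue_measure R).
Implicit Types (s : simple_fun H) (v : H) (t : R).

Lemma sf_app_dotE s v t :
  dot (sf_app s t) v = \sum_i \1_(@sf_set _ _ s i) t * dot (@sf_val _ _ s i) v.
Proof. by rewrite dot_suml; apply: eq_bigr => i _; rewrite dotZl. Qed.

Lemma measurable_sf_app_dot s v : measurable_fun setT (fun t => dot (sf_app s t) v).
Proof.
under eq_fun do rewrite sf_app_dotE.
apply: measurable_sum => i; apply: measurable_funM; last exact: measurable_cst.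
by apply: measurable_indic; exact: sf_measurable.
Qed.

Lemma measurable_sf_app_dot2 s1 s2 :
  measurable_fun setT (fun t => dot (sf_app s1 t) (sf_app s2 t)).
Proof.
under eq_fun do rewrite sf_app_dotE.
apply: measurable_sum => i; apply: measurable_funM.
  by apply: measurable_indic; exact: sf_measurable.
by under eq_fun do rewrite dotC; exact: measurable_sf_app_dot.
Qed.

Lemma measurable_sf_app_dist s1 s2 :
  measurable_fun setT (fun t => `|sf_app s1 t - sf_app s2 t|).
Proof.
have -> : (fun t => `|sf_app s1 t - sf_app s2 t|) = Num.sqrt \o (fun t =>
    dot (sf_app s1 t) (sf_app s1 t) - dot (sf_app s1 t) (sf_app s2 t) -
    (dot (sf_app s2 t) (sf_app s1 t) - dot (sf_app s2 t) (sf_app s2 t))).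
  by apply/funext => t; rewrite dot_normE/= dotBl !dotBr.
apply: measurableT_comp.
  by apply: continuous_measurable_fun; exact: sqrt_continuous.
by apply: measurable_funB; apply: measurable_funB; exact: measurable_sf_app_dot2.
Qed.

(** The link from Bochner sums to Lebesgue integrals. Every set of a simple function meets the
    bounded interval in finite measure, so the [fine] in [sf_integral] loses nothing. *)
Lemma sf_integral_dot a b s v :
  mu.-integrable `]a, b[ (fun t => (dot (sf_app s t) v)%:E) /\
  (\int[mu]_(t in `]a, b[) (dot (sf_app s t) v)%:E =
   (dot (sf_integral a b s) v)%:E)%E.
Proof.
have fin (A : set R) : measurable A -> (mu (A `&` `]a, b[) < +oo)%E.
  move=> mA; apply: (@le_lt_trans _ _ (mu `]a, b[)).
    by apply: le_measure => //; rewrite inE//; exact: measurableI.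
  by rewrite lebesgue_measure_itv/=; case: ifP => // _; rewrite -EFinB ltry.
pose g i t := ((dot (@sf_val _ _ s i) v)%:E * (\1_(@sf_set _ _ s i) t)%:E)%E.
have i1 i : mu.-integrable `]a, b[ (EFin \o \1_(@sf_set _ _ s i)).
  apply/integrableP; split.
    by apply/measurable_EFinP; apply: measurable_indic; exact: sf_measurable.
  under eq_integral do rewrite /= ger0_norm//.
  by rewrite integral_indic//; [apply: fin|]; exact: sf_measurable.
have ig i : mu.-integrable `]a, b[ (g i).
  by apply: integrableZl; [exact: measurable_itv|exact: i1].
have -> : (fun t => (dot (sf_app s t) v)%:E) = (fun t => \sum_i g i t)%E.
  apply/funext => t; rewrite sf_app_dotE -sumEFin.
  by apply: eq_bigr => i _; rewrite /g mulrC EFinM.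
split; first exact: integrable_sum.
rewrite integral_sum// /sf_integral dot_suml -sumEFin.
apply: eq_bigr => i _; rewrite /g integralZl; [|exact: measurable_itv|exact: i1].
rewrite integral_indic; [|exact: measurable_itv|exact: sf_measurable].
rewrite dotZl mulrC EFinM fineK// ge0_fin_numE//.
by apply: fin; exact: sf_measurable.
Qed.

End simple_functions.

(* The functions [`|f t - sf_app (s n) t|] need not be Borel measurable, so
   their integral is a priori only a lower integral. *)
Section lower_integral.
Variables (R : realType).
Local Notation mu := (@lebesgue_measure R).

(** The integral of a nonnegative function is a supremum over the simple functions below it, and
    these only grow in number with the function; measurability does not enter. *)
Lemma le_lower_integral (D : set R) (f g : R -> \bar R) :
  (forall t, D t -> 0 <= f t)%E -> (forall t, D t -> f t <= g t)%E ->
  (\int[mu]_(t in D) f t <= \int[mu]_(t in D) g t)%E.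
Proof.
move=> f0 fg; have g0 t : D t -> (0 <= g t)%E.
  by move=> Dt; exact: le_trans (f0 _ Dt) (fg _ Dt).
rewrite !ge0_integralE//; apply: le_ereal_sup => _ [h /= hf <-].
exists h => // t; apply: le_trans (hf t) _; rewrite !patchE; case: ifPn => //.
by rewrite inE => /fg.
Qed.

End lower_integral.

Section bochner_scalarization.
Variables (R : realType) (H : hilbertType R).
Local Notation mu := (@lebesgue_measure R).

(* Off a Borel null set the integrand is a limit of simple functions, which
   provides a measurable minorant of the lower integral. *)
Lemma bochner_measurable_dist (a b : R) (f : R -> H) (s : nat -> simple_fun H) :
  {ae mu, forall t, t \in `]a, b[ -> sf_app (s n) t @[n --> \oo] --> f t} ->
  exists N : set R, [/\ measurable N, mu N = 0%E,
    forall t, t \in `]a, b[ -> ~ N t -> sf_app (s n) t @[n --> \oo] --> f t &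
    forall s', measurable_fun (`]a, b[ `\` N) (fun t => `|f t - sf_app s' t|)].
Proof.
move=> [N [mN N0 sN]]; exists N; have cvN t : t \in `]a, b[ -> ~ N t ->
    sf_app (s n) t @[n --> \oo] --> f t.
  by move=> tab Nt; apply: contrapT => h; apply/Nt/sN => /= /(_ tab).
split => // s'; apply: (@measurable_fun_cvg _ _ _ _
    (fun n t => `|sf_app (s n) t - sf_app s' t|)).
  by move=> n; apply: measurable_funTS; exact: measurable_sf_app_dist.
move=> t [/= tab Nt]; apply: cvg_norm; apply: cvgB; last exact: cvg_cst.
exact: cvN.
Qed.

(** Almost everywhere <s_n, v> <= k + |v| |f - s_n| for the approximating simple functions s_n.
    Integrate, then let n tend to infinity: the error term vanishes. *)
Lemma bochner_dot_le (a b : R) (f : R -> H) (I v : H) (k : R -> R) :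
  is_bochner_integral a b f I ->
  mu.-integrable `]a, b[ (EFin \o k) ->
  {ae mu, forall t, t \in `]a, b[ -> dot (f t) v <= k t} ->
  ((dot I v)%:E <= \int[mu]_(t in `]a, b[) (k t)%:E)%E.
Proof.
move=> [s [sf sfi sI]] ik [N' [mN' N'0 fk]].
have [N [mN N0 cvN mdist]] := bochner_measurable_dist sf.
(* On [D] all integrands are measurable, so the integral is additive there; the removed part is
   null. *)
pose D := `]a, b[%classic `\` (N `|` N').
have mD : measurable D by apply: measurableD => //; exact: measurableU.
have NN0 : mu (N `|` N') = 0%E.
  by rewrite measureU0.
have DN : D `<=` `]a, b[%classic `\` N by move=> t [? h]; split => // ?; apply: h; left.
have Dab : D `<=` `]a, b[%classic by move=> t [].
have md n : measurable_fun D (fun t => `|f t - sf_app (s n) t|).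
  apply: (measurable_funS _ DN (mdist _)).
  by apply: measurableD => //; exact: measurable_itv.
have le_n n : ((dot (sf_integral a b (s n)) v)%:E <=
    \int[mu]_(t in `]a, b[) (k t)%:E +
    (`|v| + 1)%:E * \int[mu]_(t in `]a, b[) `|f t - sf_app (s n) t|%:E)%E.
  have [isn <-] := sf_integral_dot a b (s n) v.
  have ledist : (\int[mu]_(t in D) `|f t - sf_app (s n) t|%:E <=
      \int[mu]_(t in `]a, b[) `|f t - sf_app (s n) t|%:E)%E.
    rewrite integral_mkcond [leRHS]integral_mkcond; apply: le_lower_integral => t _.
      by rewrite patchE; case: ifPn.
    rewrite !patchE; have [tD|tD] := boolP (t \in D).
      by rewrite ifT// inE; apply: Dab; rewrite inE in tD.
    by case: (t \in _) => //; change (0 <= `|f t - sf_app (s n) t|%:E)%E; rewrite lee_fin.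
  have kfin : (\int[mu]_(t in `]a, b[) (k t)%:E)%E \is a fin_num.
    by apply: integrable_fin_num ik; exact: measurable_itv.
  have ikD : mu.-integrable D (EFin \o k).
    apply: integrableS ik; [exact: measurable_itv|exact: mD|exact: Dab].
  have isD : mu.-integrable D (fun t : R => (dot (sf_app (s n) t) v)%:E).
    apply: integrableS isn; [exact: measurable_itv|exact: mD|exact: Dab].
  (* If the distance has infinite integral, the right-hand side is +oo. Here the factor [|v| + 1]
     has to be positive, which |v| might not be. *)
  have [foo|foo] := eqVneq (\int[mu]_(t in D) `|f t - sf_app (s n) t|%:E)%E +oo%E.
    move: ledist; rewrite foo leye_eq => /eqP ->.
    rewrite gt0_muley ?lte_fin ?ltr_wpDl// addey ?leey// -ltNye.
    by move: kfin; rewrite fin_numElt => /andP[].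
  have idist : mu.-integrable D (fun t => `|f t - sf_app (s n) t|%:E).
    apply/integrableP; split; first by apply/measurable_EFinP; exact: md.
    under eq_integral do rewrite /= ger0_norm//.
    by rewrite ltey.
  rewrite (negligible_integral _ _ isn NN0)//; last exact: measurableU.
  rewrite (negligible_integral _ _ ik NN0)//; last exact: measurableU.
  apply: (@le_trans _ _ (\int[mu]_(t in D) (k t)%:E +
    (`|v| + 1)%:E * \int[mu]_(t in D) `|f t - sf_app (s n) t|%:E)%E); last first.
    by rewrite leeD2l// lee_wpmul2l// lee_fin addr_ge0.
  rewrite -integralZl// -integralD//; last exact: integrableZl.
  apply: le_integral => //; first by apply: integrableD => //; exact: integrableZl.
  move=> t; rewrite inE => -[tab tN]; rewrite -EFinM -EFinD lee_fin.
  have ft : dot (f t) v <= k t.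
    by apply: contrapT => h; apply: tN; right; apply: fk => /= /(_ tab).
  have := dot_abs_le (f t - sf_app (s n) t) v.
  rewrite dotBl ler_norml => /andP[+ _]; have := normr_ge0 (f t - sf_app (s n) t).
  set d := `|_|; set e := dot (f t) v in ft *; set e' := dot _ v; set m := `|v|.
  move: ft; nra.
rewrite -[leRHS]adde0 -(mule0 (`|v| + 1)%:E).
apply: (@lee_cvg_to _ \oo _ _ _ _ _ _ _ _ (nearW _ le_n)).
  apply: cvg_EFin; first exact: nearW.
  exact: cvg_dot (cvg_cst _).
apply: cvgeD; last 2 first.
- exact: cvg_cst.
- exact: cvgeZl.
by rewrite mule0 fin_num_adde_defl.
Qed.

End bochner_scalarization.

(** * Weak derivatives *)

Section spline.
Variable R : realType.
Implicit Types (d e r s t u : R).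

(** With this criterion the splines are differentiated from one uniform remainder bound, without a
    separate discussion of the knots. *)
Lemma derive_quadratic_remainder (f : R -> R) (C d t : R) :
  (forall s, `|f s - f t - d * (s - t)| <= C * (s - t) ^+ 2) ->
  is_derive t 1 f d.
Proof.
move=> fC.
have C0 : 0 <= C.
  have := le_trans (normr_ge0 _) (fC (t + 1)).
  by rewrite addrAC subrr add0r expr1n mulr1.
have fd : u^-1 *: ((f \o shift t) (u *: 1) - f t) @[u --> 0^'] --> d.
  apply/cvgrPdist_le => e e0; apply/nbhs_ballP.
  exists (e / (C + 1)); first by rewrite /= divr_gt0// ltr_wpDl.
  move=> u; rewrite -ball_normE /= sub0r normrN => ue u0.
  have nu : 0 < `|u| by rewrite normr_gt0.
  have -> : d - u^-1 *: (f (u *: 1 + t) - f t) =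
      - (u^-1 * (f (u + t) - f t - d * (u + t - t))).
    by rewrite [u *: 1]mulr1 [_ *: _]mulrC; field.
  rewrite normrN normrM normfV ler_pdivrMl//; apply: le_trans (fC _) _.
  rewrite addrK -real_normK ?num_real// expr2 mulrCA ler_pM2l//.
  move: ue; rewrite ltr_pdivlMr ?ltr_wpDl// => ue.
  by apply: le_trans (ltW ue); rewrite mulrC ler_pM2l// lerDl.
by apply: DeriveDef; [apply/cvg_ex; exists d|apply/cvg_lim].
Qed.

Lemma lipschitz_continuous (f : R -> R) (K : R) :
  (forall s t, `|f s - f t| <= K * `|s - t|) -> continuous f.
Proof.
move=> fK t.
have K0 : 0 <= K.
  have := le_trans (normr_ge0 _) (fK (t + 1) t).
  by rewrite addrAC subrr add0r normr1 mulr1.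
apply/(@cvgrPdist_le _ _ _ (nbhs t)) => e e0; apply/nbhs_ballP.
exists (e / (K + 1)); first by rewrite /= divr_gt0// ltr_wpDl.
move=> u; rewrite -ball_normE /= ltr_pdivlMr ?ltr_wpDl// => ue.
apply: le_trans (fK _ _) _; apply: le_trans (ltW ue).
by rewrite mulrC ler_wpM2l// lerDl.
Qed.

Definition pos u : R := Num.max u 0.

(* The C^1 quadratic spline rising from 0 to 1 on [0, 2 d]. *)
Definition step d u : R :=
  (pos u ^+ 2 - 2 * pos (u - d) ^+ 2 + pos (u - 2 * d) ^+ 2) / (2 * d ^+ 2).

(** The derivative of [step d]: the hat function on [0, 2 d] with height 1 / d, hence with integral
    1. *)
Definition dstep d u : R := (pos u - 2 * pos (u - d) + pos (u - 2 * d)) / d ^+ 2.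

Lemma posP u : (0 <= u /\ pos u = u) \/ (u <= 0 /\ pos u = 0).
Proof.
rewrite /pos; have [u0|u0] := leP 0 u; [left|right]; split => //.
exact: ltW.
Qed.

Lemma pos_remainder s t :
  `|pos s ^+ 2 - pos t ^+ 2 - 2 * pos t * (s - t)| <= (s - t) ^+ 2.
Proof.
have s2 := sqr_ge0 s; have t2 := sqr_ge0 t; have st2 := sqr_ge0 (s - t).
rewrite ler_norml; case: (posP s) => -[s0 ->]; case: (posP t) => -[t0 ->].
- by apply/andP; split; lra.
- by have := mulr_ge0_le0 s0 t0; move=> st; apply/andP; split; lra.
- by have := mulr_le0_ge0 s0 t0; move=> st; apply/andP; split; lra.
- by apply/andP; split; lra.
Qed.

Lemma pos_lipschitz s t : `|pos s - pos t| <= `|s - t|.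
Proof.
rewrite ler_norml; case: (ger0P (s - t)) => st;
by case: (posP s) => -[s0 ->]; case: (posP t) => -[t0 ->];
  apply/andP; split; lra.
Qed.

(** The three truncated squares have weights 1, 2 and 1, each with remainder at most (s - t)^2, and
    4 / (2 d^2) = 2 / d^2. *)
Lemma step_remainder d s t : 0 < d ->
  `|step d s - step d t - dstep d t * (s - t)| <= 2 / d ^+ 2 * (s - t) ^+ 2.
Proof.
move=> d0; have d2 : 0 < d ^+ 2 by rewrite exprn_gt0.
have -> : step d s - step d t - dstep d t * (s - t) = (2 * d ^+ 2)^-1 * (
    (pos s ^+ 2 - pos t ^+ 2 - 2 * pos t * (s - t))
    - 2 * (pos (s - d) ^+ 2 - pos (t - d) ^+ 2 - 2 * pos (t - d) * ((s - d) - (t - d)))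
    + (pos (s - 2 * d) ^+ 2 - pos (t - 2 * d) ^+ 2
        - 2 * pos (t - 2 * d) * ((s - 2 * d) - (t - 2 * d)))).
  by rewrite /step /dstep; field; rewrite gt_eqF.
rewrite normrM gtr0_norm ?invr_gt0 ?mulr_gt0//.
have -> : 2 / d ^+ 2 * (s - t) ^+ 2 = (2 * d ^+ 2)^-1 * (4 * (s - t) ^+ 2).
  by field; rewrite gt_eqF.
rewrite ler_pM2l ?invr_gt0 ?mulr_gt0//.
have := pos_remainder s t; have := pos_remainder (s - d) (t - d).
have := pos_remainder (s - 2 * d) (t - 2 * d).
have -> : s - d - (t - d) = s - t by ring.
have -> : s - 2 * d - (t - 2 * d) = s - t by ring.
rewrite !ler_norml; lra.
Qed.

Lemma dstep_lipschitz d s t : 0 < d ->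
  `|dstep d s - dstep d t| <= 4 / d ^+ 2 * `|s - t|.
Proof.
move=> d0; have d2 : 0 < d ^+ 2 by rewrite exprn_gt0.
have -> : dstep d s - dstep d t = (d ^+ 2)^-1 * ((pos s - pos t)
    - 2 * (pos (s - d) - pos (t - d)) + (pos (s - 2 * d) - pos (t - 2 * d))).
  by rewrite /dstep; field; rewrite gt_eqF.
rewrite normrM gtr0_norm ?invr_gt0// mulrAC mulrC ler_pM2r ?invr_gt0//.
have := pos_lipschitz s t; have := pos_lipschitz (s - d) (t - d).
have := pos_lipschitz (s - 2 * d) (t - 2 * d).
have -> : s - d - (t - d) = s - t by ring.
have -> : s - 2 * d - (t - 2 * d) = s - t by ring.
rewrite !ler_norml; lra.
Qed.

Lemma step_le0 d u : 0 < d -> u <= 0 -> step d u = 0 /\ dstep d u = 0.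
Proof.
move=> d0 u0; rewrite /step /dstep.
have -> : pos u = 0 by case: (posP u) => -[? ->] //; lra.
have -> : pos (u - d) = 0 by case: (posP (u - d)) => -[? ->] //; lra.
have -> : pos (u - 2 * d) = 0 by case: (posP (u - 2 * d)) => -[? ->] //; lra.
by split; ring.
Qed.

Lemma step_ge d u : 0 < d -> 2 * d <= u -> step d u = 1 /\ dstep d u = 0.
Proof.
move=> d0 ud; rewrite /step /dstep.
have -> : pos u = u by case: (posP u) => -[? ->] //; lra.
have -> : pos (u - d) = u - d by case: (posP (u - d)) => -[? ->] //; lra.
have -> : pos (u - 2 * d) = u - 2 * d by case: (posP (u - 2 * d)) => -[? ->] //; lra.
by split; field; rewrite gt_eqF.
Qed.

Lemma step_itv d u : 0 < d -> 0 <= step d u <= 1.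
Proof.
move=> d0; have d2 : 0 < 2 * d ^+ 2 by rewrite mulr_gt0// exprn_gt0.
rewrite /step; apply/andP; split.
  apply: divr_ge0 (ltW d2).
  by case: (posP u) => -[? ->]; case: (posP (u - d)) => -[? ->];
    case: (posP (u - 2 * d)) => -[? ->]; nra.
rewrite ler_pdivrMr// mul1r.
by case: (posP u) => -[? ->]; case: (posP (u - d)) => -[? ->];
  case: (posP (u - 2 * d)) => -[? ->]; nra.
Qed.

Lemma dstep_ge0 d u : 0 < d -> 0 <= dstep d u.
Proof.
move=> d0; have d2 : 0 < d ^+ 2 by rewrite exprn_gt0.
rewrite /dstep divr_ge0 ?(ltW d2)//.
by case: (posP u) => -[? ->]; case: (posP (u - d)) => -[? ->];
    case: (posP (u - 2 * d)) => -[? ->]; lra.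
Qed.

End spline.

(** * Absolute continuity of the integral and a monotonicity criterion *)

Section finite_integral.
Variables (R : realType) (h : R -> R).
Local Notation mu := (@lebesgue_measure R).
Hypotheses (h0 : forall t, 0 <= h t) (hint : mu.-integrable setT (EFin \o h)).
Implicit Types (A B : set R).

Lemma integrable_restrict A : measurable A -> mu.-integrable A (EFin \o h).
Proof. by move=> mA; apply: integrableS hint. Qed.

Lemma Rintegral_ge0_le A B : measurable A -> measurable B -> A `<=` B ->
  \int[mu]_(t in A) h t <= \int[mu]_(t in B) h t.
Proof.
move=> mA mB AB; apply: fine_le.
- exact: integrable_fin_num (integrable_restrict mA).
- exact: integrable_fin_num (integrable_restrict mB).
- apply: ge0_subset_integral => //.
    by apply: measurable_funTS; exact: measurable_int hint.
  by move=> t _; rewrite lee_fin.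
Qed.

Lemma RintegralU A B : measurable A -> measurable B -> [disjoint A & B] ->
  \int[mu]_(t in A `|` B) h t = \int[mu]_(t in A) h t + \int[mu]_(t in B) h t.
Proof.
move=> mA mB AB; apply: Rintegral_setU => //.
by apply: integrable_restrict; exact: measurableU.
Qed.

Lemma Rintegral_small e : 0 < e -> exists2 d, 0 < d &
  forall A, measurable A -> (mu A < d%:E)%E -> \int[mu]_(t in A) h t < e.
Proof.
move=> /(integral_normr_continuous hint)[d [d0 hd]]; exists d => // A mA Ad.
apply: le_lt_trans (hd A mA Ad).
by under [leRHS]eq_Rintegral do rewrite ger0_norm//.
Qed.

End finite_integral.

Section monotonicity.
Variables (R : realType).
Local Notation mu := (@lebesgue_measure R).

(* Continuous induction on the right end point [t] of the estimate
   [W t - W a <= e * (t - a) + \int_([a, t] `&` O) h], where the open set [O]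
   covers the exceptional null set and [\int_O h < e]. *)
Lemma ac_nonincreasing (W h : R -> R) (a b : R) : a < b ->
  (forall t, 0 <= h t) -> mu.-integrable setT (EFin \o h) ->
  (forall s t, a <= s -> s < t -> t <= b ->
     `|W t - W s| <= \int[mu]_(r in `[s, t]) h r) ->
  {ae mu, forall t, t \in `]a, b[ -> derivable W t 1 /\ derive1 W t <= 0} ->
  W b <= W a.
Proof.
move=> ab h0 hint hW [N [mN N0 dN]].
suff H e : 0 < e -> W b - W a <= e * (b - a) + e.
  rewrite -subr_le0; apply/ler_addgt0Pr => e e0; rewrite add0r.
  have p : 0 < b - a + 1 by rewrite ltr_pwDr// subr_ge0 ltW.
  have := H (e / (b - a + 1)); rewrite divr_gt0// => /(_ isT) /le_trans; apply.
  by rewrite -[X in _ + X <= _]mulr1 -mulrDr divfK ?gt_eqF.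
move=> e0.
have [d d0 hd] := Rintegral_small h0 hint e0.
(* The left end point is treated as exceptional too, since nothing is known about the derivative
   there. *)
have mNa : measurable (N `|` [set a]) by exact: measurableU.
have Na0 : mu (N `|` [set a]) = 0%E by rewrite measureU0//; exact: lebesgue_measure_set1.
have Naoo : (mu (N `|` [set a]) < +oo)%E by rewrite Na0.
have [ O [Oop NO Od]] := lebesgue_regularity_outer mNa Naoo d0.
have mO : measurable O by exact: open_measurable.
have muO : (mu O < d%:E)%E.
  have mD : measurable (O `\` (N `|` [set a])) by exact: measurableD.
  rewrite -(setDUK NO); apply: le_lt_trans (measureU2 mu mNa mD) _.
  by rewrite [X in (X + _)%E]Na0 add0e.
pose G t := \int[mu]_(r in `[a, t] `&` O) h r.
have mG t : measurable (`[a, t] `&` O) by exact: measurableI.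
have G0 t : 0 <= G t by apply: Rintegral_ge0.
have Gle s t : s <= t -> G s <= G t.
  move=> st; apply: Rintegral_ge0_le => // r [/= ar Or]; split => //.
  by move: ar; rewrite !in_itv/= => /andP[-> /le_trans ->].
have GO s t : a <= s -> s < t -> `[s, t] `<=` O ->
    \int[mu]_(r in `[s, t]) h r + G s <= G t.
  move=> as_ st stO.
  have -> : \int[mu]_(r in `[s, t]) h r = \int[mu]_(r in `]s, t]) h r.
    by rewrite Rintegral_itv_obnd_cbnd//; exact: integrable_restrict.
  have mst : measurable `]s, t] by exact: measurable_itv.
  have dst : [disjoint `]s, t]%classic & `[a, s] `&` O].
    apply/disj_setPRL => r; rewrite /= !in_itv/= => -[/andP[_ rs] _] /andP[sr _].
    by rewrite ltNge rs in sr.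
  rewrite -(RintegralU hint mst (mG s) dst).
  apply: Rintegral_ge0_le => //; first exact: measurableU.
  move=> r /= [|[]]; rewrite !in_itv/= => /andP[r1 r2].
    by split; [rewrite (le_trans as_ (ltW r1))|apply: stO; rewrite /= in_itv/= (ltW r1)].
  by move=> Or; rewrite r1 (le_trans r2 (ltW st)).
pose S := [set u | a <= u <= b /\ W u - W a <= e * (u - a) + G u].
have Sa : S a by split; [rewrite lexx ltW|rewrite !subrr mulr0 add0r].
have Sub : has_ubound S by exists b; move=> r [/andP[_ rb] _].
have Ssup : has_sup S by split; [exists a|].
set c := sup S.
have ac : a <= c by exact: sup_ubound.
have cb : c <= b by apply: sup_le_ub; [exists a|move=> r [/andP[_ rb] _]].
(* The supremum is attained: by absolute continuity of the integral of [h], [W] changes little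
   between [c] and nearby points of [S] on its left. *)
have Sc : S c.
  split; first by rewrite ac.
  apply/ler_addgt0Pr => eta eta0.
  have [d' d'0 hd'] := Rintegral_small h0 hint eta0.
  have [x Sx cx] := sup_adherent d'0 Ssup.
  have [/andP[ax xb] xS] := Sx.
  have : x <= c by apply: sup_ubound.
  rewrite le_eqVlt => /predU1P[<-|xc]; first by rewrite (le_trans xS)// lerDl ltW.
  have h1 : W c - W x < eta.
    apply: le_lt_trans (ler_norm _) _. apply: le_lt_trans (hW _ _ ax xc cb) _.
    apply: hd' => //; rewrite lebesgue_measure_itv/= lte_fin xc -EFinD lte_fin.
    by rewrite ltrBlDr -ltrBlDl.
  have := Gle _ _ (ltW xc).
  have : e * (x - a) <= e * (c - a) by rewrite ler_pM2l// lerD2r ltW.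
  move: xS h1; lra.
move: cb; rewrite le_eqVlt => /predU1P[cb|cb].
  have [_] := Sc; rewrite cb => /le_trans; apply; rewrite lerD2l.
  apply: le_trans (ltW (hd _ mO muO)).
  by apply: Rintegral_ge0_le => // r [].
suff [t [ct tb tS]] : exists t,
    [/\ c < t, t <= b & W t - W c <= e * (t - c) + (G t - G c)].
  have : S t.
    split; first by rewrite (le_trans ac (ltW ct)).
    by have [_] := Sc; move: tS; lra.
  by move=> /(sup_ubound Sub); rewrite leNgt ct.
(* If [c] is exceptional, an interval to its right lies in [O] and the increment of [W] is charged
   to [G]; otherwise the derivative at [c] allows a slope of at most [e]. *)
have [cN|cN] := pselect ((N `|` [set a]) c).
  have /(Oop c)/nbhs_ballP[r /= r0 rO] := NO _ cN.
  pose t := Num.min b (c + r / 2).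
  have ct : c < t by rewrite lt_min cb ltrDl divr_gt0.
  have tb : t <= b by rewrite ge_min lexx.
  exists t; split => //.
  have := GO _ _ ac ct; have := hW _ _ ac ct tb.
  move=> /(le_trans (ler_norm _)) h1 h2.
  have {}h2 := h2 _.
  have : `[c, t] `<=` O.
    move=> u /=; rewrite in_itv/= => /andP[cu ut]; apply: rO.
    rewrite -ball_normE /= ltr_norml; move: ut; rewrite le_min => /andP[_].
    move: cu r0; lra.
  move=> /h2; have : 0 <= e * (t - c) by rewrite mulr_ge0 ?subr_ge0 ?ltW.
  move: h1; lra.
have [Nc ca] : ~ N c /\ c <> a by split => hc; apply: cN; [left|right].
have cab : c \in `]a, b[.
  by rewrite in_itv/= cb andbT lt_neqAle ac andbT; apply/eqP => /esym.
have [dW dW0] : derivable W c 1 /\ derive1 W c <= 0.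
  by apply: contrapT => hc; apply: Nc; apply: dN => /= /(_ cab).
have [r /= r0 hr] : exists2 r, 0 < r & forall t, 0 < t < r -> W (t + c) - W c <= e * t.
  have /cvgrPdist_le/(_ e e0) :
      u^-1 *: (W (u *: 1 + c) - W c) @[u --> 0^'] --> derive1 W c.
    by rewrite derive1E; exact: dW.
  move=> /nbhs_ballP[r /= r0 hr]; exists r => // t /andP[t0 tr].
  have := hr t; rewrite -ball_normE /= sub0r normrN gtr0_norm// => /(_ tr).
  rewrite gt_eqF// => /(_ isT); rewrite ler_norml => /andP[+ _].
  rewrite lerBrDl; rewrite [t *: 1]mulr1 [_ *: _]mulrC => h1.
  rewrite -ler_pdivrMr//; move: h1 dW0; lra.
pose t := Num.min b (c + r / 2).
have ct : c < t by rewrite lt_min cb ltrDl divr_gt0.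
have tb : t <= b by rewrite ge_min lexx.
exists t; split => //.
have tr : t <= c + r / 2 by rewrite ge_min lexx orbT.
have := hr (t - c); rewrite subrK => /(_ _).
have := Gle _ _ (ltW ct); move=> h1 h2.
have := h2 _; rewrite subr_gt0 ct/=.
have -> : t - c < r by move: tr r0; lra.
move=> /(_ isT); move: h1; lra.
Qed.

End monotonicity.

(** * Increments of weakly differentiable functions *)

Section weak_derivative_modulus.
Variables (R : realType) (H : hilbertType R).
Local Notation mu := (@lebesgue_measure R).

Lemma sf_app_norm_le (s : simple_fun H) t :
  `|sf_app s t| <= \sum_i `|@sf_val _ _ s i|.
Proof.
apply: le_trans (ler_norm_sum _ _ _) _; apply: ler_sum => i _.
rewrite normrZ -[leRHS]mul1r ler_wpM2r// indicE.
by case: (_ \in _); rewrite ?normr1 ?normr0.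
Qed.

(** Choose n such that |f - s_n| has finite integral and bound |f| by |f - s_n| + K, where K bounds
    the simple function s_n. Extension by 0 gives a function integrable on the whole line. *)
Lemma bochner_norm_majorant (a b : R) (f : R -> H) : bochner_integrable a b f ->
  exists h : R -> R, [/\ forall t, 0 <= h t, mu.-integrable setT (EFin \o h) &
    {ae mu, forall t, t \in `]a, b[ -> `|f t| <= h t}].
Proof.
move=> [I [s [sf sfi _]]].
have [N [mN N0 cvN mdist]] := bochner_measurable_dist sf.
have [n foo] : exists n, (\int[mu]_(t in `]a, b[) `|f t - sf_app (s n) t|%:E < +oo)%E.
  have /fine_cvgP[[n _ hn] _] := sfi.
  by exists n; have := hn n (leqnn n); rewrite fin_numElt => /andP[].
pose D := `]a, b[%classic `\` N.
have mD : measurable D by apply: measurableD.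
have Dab : D `<=` `]a, b[ by move=> t [].
pose K := \sum_i `|@sf_val _ _ (s n) i|.
have ifD : mu.-integrable D (fun t => `|f t - sf_app (s n) t|%:E).
  apply/integrableP; split; first by apply/measurable_EFinP; exact: mdist.
  under eq_integral do rewrite /= ger0_norm//.
  apply: le_lt_trans foo.
  rewrite integral_mkcond [leRHS]integral_mkcond; apply: le_lower_integral => t _.
    by rewrite patchE; case: ifPn.
  rewrite !patchE; have [tD|tD] := boolP (t \in D).
    by rewrite ifT// inE; apply: Dab; rewrite inE in tD.
  by case: (t \in _) => //; change (0 <= `|f t - sf_app (s n) t|%:E)%E; rewrite lee_fin.
have iKD : mu.-integrable D (EFin \o cst K).
  apply/integrableP; split; first by apply/measurable_EFinP; exact: measurable_cst.
  rewrite /= integral_cst//; apply: lte_mul_pinfty => //.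
  apply: (@le_lt_trans _ _ (mu `]a, b[)); first by apply: le_measure; rewrite ?inE.
  by rewrite lebesgue_measure_itv/=; case: ifP => // _; rewrite -EFinB ltry.
pose h := (fun t => `|f t - sf_app (s n) t| + K) \_ D.
have hE t : h t = if t \in D then `|f t - sf_app (s n) t| + K else 0.
  by rewrite /h patchE.
exists h; split.
- move=> t; rewrite hE; case: ifP => // _; rewrite addr_ge0// /K.
  by apply: sumr_ge0.
- pose F t := (`|f t - sf_app (s n) t|%:E + K%:E)%E.
  have -> : EFin \o h = F \_ D.
    by apply/funext => t; rewrite /= hE patchE; case: ifP.
  have iD : mu.-integrable D F by apply: integrableD; [exact: mD|exact: ifD|exact: iKD].
  by apply: (@integrable_mkcond _ _ R mu D F _).1.
- exists N; split => // t /= ht; apply: contrapT => Nt; apply: ht => tab.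
  rewrite hE ifT; last by rewrite inE.
  rewrite -[f t](subrK (sf_app (s n) t)) (le_trans (ler_normD _ _))// subrK.
  by rewrite lerD2l sf_app_norm_le.
Qed.

(* Tested against [step d (r - s) - step d (r - t + 2 d)], which increases on
   [s, s + 2 d] and decreases on [t - 2 d, t], the weak derivative yields the
   increment of [dot (x _) (x t - x s)] up to [2 e]. *)
Lemma weak_derivative_modulus (T : R) (x g : R -> H) :
  {in `]0, T[, continuous x} -> weak_derivative 0 T x g ->
  bochner_integrable 0 T g ->
  exists h : R -> R, [/\ forall r, 0 <= h r, mu.-integrable setT (EFin \o h) &
    forall s t, 0 < s -> s < t -> t < T ->
      `|x t - x s| <= \int[mu]_(r in `[s, t]) h r].
Proof.
move=> xc xg /bochner_norm_majorant[h [h0 ih gh]].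
exists h; split => // s t s0 st tT.
set J := \int[mu]_(r in `[s, t]) h r.
pose v := x t - x s; pose w r := dot (x r) v.
(* The increment is measured in its own direction [v]: |v|^2 = w t - w s, and one factor |v| is
   cancelled at the end. *)
suff key e : 0 < e -> `|v| ^+ 2 - 2 * e <= `|v| * J.
  have {}key : `|v| ^+ 2 <= `|v| * J.
    apply/ler_addgt0Pr => e e0; have := key (e / 2); rewrite divr_gt0// => /(_ isT).
    by rewrite mulrC divfK// lerBlDr.
  rewrite -/v; have := normr_ge0 v; rewrite le_eqVlt => /predU1P[<-|v0].
    exact: Rintegral_ge0.
  by rewrite -(ler_pM2l v0) -expr2.
move=> e0.
have wc r : 0 < r < T -> w u @[u --> r] --> w r.
  by move=> rT; apply: cvg_dot; [apply: xc; rewrite in_itv|exact: cvg_cst].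
(* The ramps of the test function do not overlap, and [w] varies by at most [e] on each of them. *)
have [d [d0 d4 ds dt]] : exists d, [/\ 0 < d, 4 * d <= t - s,
    forall r, s <= r <= s + 2 * d -> `|w r - w s| <= e &
    forall r, t - 2 * d <= r <= t -> `|w r - w t| <= e].
  have sT : 0 < s < T by rewrite s0 (lt_trans st).
  have tT' : 0 < t < T by rewrite tT (lt_trans s0).
  have /cvgrPdist_le/(_ e e0)/nbhs_ballP[d1 /= d10 h1] := wc _ sT.
  have /cvgrPdist_le/(_ e e0)/nbhs_ballP[d2 /= d20 h2] := wc _ tT'.
  pose d := Num.min (Num.min (d1 / 4) (d2 / 4)) ((t - s) / 4).
  have dd1 : d <= d1 / 4 by rewrite /d !ge_min lexx.
  have dd2 : d <= d2 / 4 by rewrite /d !ge_min lexx orbT.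
  have dst : d <= (t - s) / 4 by rewrite /d !ge_min lexx !orbT.
  exists d; split.
  - by rewrite !lt_min !divr_gt0// subr_gt0.
  - by move: dst; lra.
  - move=> r rs; rewrite distrC; apply: h1; rewrite -ball_normE /= ltr_norml.
    by move: rs dd1 d10; lra.
  - move=> r rs; rewrite distrC; apply: h2; rewrite -ball_normE /= ltr_norml.
    by move: rs dd2 d20; lra.
pose phi r := step d (r - s) - step d (r - (t - 2 * d)).
pose dphi r := dstep d (r - s) - dstep d (r - (t - 2 * d)).
have dstepE (r c : R) : is_derive r 1 (fun u : R => step d (u - c)) (dstep d (r - c)).
  apply: (@derive_quadratic_remainder _ _ (2 / d ^+ 2)) => u.
  by have := step_remainder (u - c) (r - c) d0; have -> : u - c - (r - c) = u - r by ring.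
have dphiE (r : R) : is_derive r 1 phi (dphi r) by exact: is_deriveB.
have dstepC (c : R) : continuous (fun u : R => dstep d (u - c)).
  apply: (@lipschitz_continuous _ _ (4 / d ^+ 2)) => u1 u2.
  have := dstep_lipschitz (u1 - c) (u2 - c) d0.
  by have -> : u1 - c - (u2 - c) = u1 - u2 by ring.
have dphi1 : derive1 phi = dphi.
  by apply/funext => r; rewrite derive1E; exact: derive_val.
have phi_out r : r <= s \/ t <= r -> phi r = 0.
  case=> rst; rewrite /phi.
    have [-> _] : step d (r - s) = 0 /\ dstep d (r - s) = 0.
      by apply: step_le0 => //; lra.
    have [-> _] : step d (r - (t - 2 * d)) = 0 /\ dstep d (r - (t - 2 * d)) = 0.
      by apply: step_le0 => //; lra.
    by rewrite subrr.
  have [-> _] : step d (r - s) = 1 /\ dstep d (r - s) = 0.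
    by apply: step_ge => //; lra.
  have [-> _] : step d (r - (t - 2 * d)) = 1 /\ dstep d (r - (t - 2 * d)) = 0.
    by apply: step_ge => //; lra.
  by rewrite subrr.
have phi_itv r : 0 <= phi r <= 1.
  have := step_itv (r - s) d0; have := step_itv (r - (t - 2 * d)) d0.
  rewrite /phi => a1 a2; have [rt|rt] := leP r (t - 2 * d).
    have [-> _] : step d (r - (t - 2 * d)) = 0 /\ dstep d (r - (t - 2 * d)) = 0.
      by apply: step_le0 => //; lra.
    by rewrite subr0.
  have [-> _] : step d (r - s) = 1 /\ dstep d (r - s) = 0.
    by apply: step_ge => //; lra.
  by move: a1; lra.
have test : test_function 0 T phi.
  split.
  - by move=> r; exact: ex_derive.
  - by rewrite dphi1 => r; apply: cvgB; exact: dstepC.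
  - exists s, t; split => // r; rewrite in_itv/= negb_and -!ltNge => rst.
    by apply: phi_out; case/orP: rst => /ltW; [left|right].
have [I hI hI'] := xg phi test.
have T0 : 0 < T by rewrite (lt_trans s0)// (lt_trans st).
(* A majorant of [dphi r * w r]: [w] is replaced by [w s + e] on the rising ramp and by [w t - e] on
   the falling one. Its primitive [K] is explicit, and its integral is w s - w t + 2 e. *)
pose k r := (w s + e) * dstep d (r - s) - (w t - e) * dstep d (r - (t - 2 * d)).
pose K r := (w s + e) * step d (r - s) - (w t - e) * step d (r - (t - 2 * d)).
have kc : continuous k.
  by move=> r; apply: cvgB; apply: cvgM; (try exact: cvg_cst); exact: dstepC.
have kint : mu.-integrable `[0, T] (EFin \o k).
  apply: continuous_compact_integrable; first exact: segment_compact.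
  exact: continuous_subspaceT.
have Kk (r : R) : is_derive r 1 K (k r).
  have dZ (a c : R) :
      is_derive r 1 (fun u : R => a * step d (u - c)) (a * dstep d (r - c)).
    exact: is_deriveZ.
  exact: is_deriveB.
have intk : (\int[mu]_(r in `]0%R, T[) (k r)%:E = (w s - w t + 2 * e)%:E)%E.
  have mk : measurable_fun setT (EFin \o k).
    by apply/measurable_EFinP; exact: continuous_measurable_fun.
  rewrite integral_itv_bndo_bndc; last exact: measurable_funTS.
  rewrite integral_itv_obnd_cbnd; last exact: measurable_funTS.
  rewrite (@continuous_FTC2 _ k K)//; last 3 first.
  - exact: continuous_subspaceT.
  - have Kc : continuous K.
      move=> r; apply: differentiable_continuous; apply/derivable1_diffP.
      exact: ex_derive.
    split; first by move=> r _; exact: ex_derive.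
      by apply: cvg_at_right_filter; exact: Kc.
    by apply: cvg_at_left_filter; exact: Kc.
  - by move=> r _; rewrite derive1E; exact: derive_val.
  have [sT _] : step d (T - s) = 1 /\ dstep d (T - s) = 0.
    by apply: step_ge => //; lra.
  have [tT1 _] : step d (T - (t - 2 * d)) = 1 /\ dstep d (T - (t - 2 * d)) = 0.
    by apply: step_ge => //; lra.
  have [s1 _] : step d (0 - s) = 0 /\ dstep d (0 - s) = 0.
    by apply: step_le0 => //; lra.
  have [t1 _] : step d (0 - (t - 2 * d)) = 0 /\ dstep d (0 - (t - 2 * d)) = 0.
    by apply: step_le0 => //; lra.
  by rewrite -EFinB /K sT tT1 s1 t1; congr EFin; ring.
have h1 : dot I v <= w s - w t + 2 * e.
  rewrite -lee_fin -intk; apply: bochner_dot_le hI _ _.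
    apply: integrableS kint; [exact: measurable_itv|exact: measurable_itv|].
    exact: subset_itv_oo_cc.
  apply: aeW => r _; rewrite dotZl dphi1 /dphi /k -/(w r) mulrBl.
  have p1 := dstep_ge0 (r - s) d0; have p2 := dstep_ge0 (r - (t - 2 * d)) d0.
  apply: lerB.
    have [rs|rs] := leP s r; last first.
      have [_ ->] : step d (r - s) = 0 /\ dstep d (r - s) = 0.
        by apply: step_le0 => //; lra.
      by rewrite mulr0 mul0r.
    have [rd|rd] := leP r (s + 2 * d); last first.
      have [_ ->] : step d (r - s) = 1 /\ dstep d (r - s) = 0.
        by apply: step_ge => //; lra.
      by rewrite mulr0 mul0r.
    rewrite mulrC ler_wpM2r//; have := ds r; rewrite rs rd => /(_ isT).
    rewrite ler_norml; lra.
  have [rs|rs] := leP r t; last first.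
    have [_ ->] : step d (r - (t - 2 * d)) = 1 /\ dstep d (r - (t - 2 * d)) = 0.
      by apply: step_ge => //; lra.
    by rewrite mulr0 mul0r.
  have [rd|rd] := leP (t - 2 * d) r; last first.
    have [_ ->] : step d (r - (t - 2 * d)) = 0 /\ dstep d (r - (t - 2 * d)) = 0.
      by apply: step_le0 => //; lra.
    by rewrite mulr0 mul0r.
  rewrite mulrC ler_wpM2l//; have := dt r; rewrite rs rd => /(_ isT).
  rewrite ler_norml; lra.
(* The vector - I is the integral of [phi r *: g r], where [phi] has values in [0, 1], vanishes off
   [s, t], and |g| <= h. *)
have h2 : dot (- I) v <= `|v| * J.
  pose h' r := `|v| * (h \_ `[s, t]) r.
  have ih' : mu.-integrable setT (EFin \o h').
    have -> : EFin \o h' = (fun r => `|v|%:E * ((EFin \o h) \_ `[s, t]) r)%E.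
      by apply/funext => r; rewrite /h' /= EFinM restrict_EFin.
    apply: integrableZl; first exact: measurableT.
    apply: (@integrable_mkcond _ _ R mu `[s, t] (EFin \o h) _).1 => //.
    exact: integrable_restrict.
  have ih0T : mu.-integrable `]0, T[ (EFin \o h').
    by apply: integrableS ih'; [exact: measurableT|exact: measurable_itv|].
  have -> : `|v| * J = \int[mu]_(r in `]0, T[) h' r.
    rewrite /h' RintegralZl//.
      rewrite -Rintegral_mkcondr; congr (_ * Rintegral _ _ _).
      apply/seteqP; split => r /=; last by case.
      rewrite !in_itv/= => /andP[r1 r2].
      by rewrite r1 r2 (lt_le_trans s0)// (le_lt_trans r2).
    rewrite -restrict_EFin.
    apply: integrableS; [exact: measurableT|exact: measurable_itv|by []|].
    apply: (@integrable_mkcond _ _ R mu `[s, t] (EFin \o h) _).1 => //.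
    exact: integrable_restrict.
  rewrite -lee_fin /Rintegral fineK; last first.
    by apply: integrable_fin_num; [exact: measurable_itv|exact: ih0T].
  apply: bochner_dot_le hI' ih0T _.
  move: gh => [Z [mZ Z0 gZ]]; exists Z; split => // r /= nr; apply: gZ => /= ghr.
  apply: nr => r0T; have {}ghr := ghr r0T.
  rewrite dotZl /h' patchE; have [rst|rst] := boolP (r \in `[s, t]).
    rewrite ifT ?inE//; have /andP[p0 p1] := phi_itv r.
    apply: (@le_trans _ _ (phi r * (`|g r| * `|v|))).
      by rewrite ler_wpM2l// dot_CauchySchwarz.
    apply: (@le_trans _ _ (1 * (`|g r| * `|v|))).
      by rewrite ler_wpM2r// mulr_ge0.
    by rewrite mul1r mulrC ler_wpM2l.
  rewrite (phi_out r); last first.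
    move: rst; rewrite in_itv/= negb_and -!ltNge => /orP[/ltW|/ltW]; by [left|right].
  by rewrite mul0r mulr_ge0//; case: ifP.
have -> : `|v| ^+ 2 = w t - w s by rewrite -dot_norm {1}/v dotBl.
rewrite dotNl in h2; move: h1 h2; lra.
Qed.

End weak_derivative_modulus.

(** * Decay of quadratic forms along strong solutions *)

Section form_decay.
Variables (R : realType) (X U : hilbertType R) (M : pop X X) (B : U -> X).
Variables (ub : U) (xb x0 : X) (x : R -> X).
Local Notation mu := (@lebesgue_measure R).
Hypotheses (xbE : M xb = B ub) (xsol : strong_solution M B (fun=> ub) x0 x).

Lemma strong_solution_continuous t : 0 < t -> {for t, continuous x}.
Proof.
move=> t0; have t1 : 0 < t + 1 by rewrite addr_gt0.
have [/(continuous_within_itvP _ t1)[xc _ _] _ _ _ _] := xsol t1.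
by apply: xc; rewrite in_itv/= t0 ltrDl ltr01.
Qed.

Lemma strong_solution_cvg_right t : 0 <= t -> x @ t^'+ --> x t.
Proof.
rewrite le_eqVlt => /predU1P[<-|t0].
  have [/(continuous_within_itvP _ (@ltr01 R))[_ xc _] _ _ _ _] := xsol (@ltr01 R).
  exact: xc.
by apply: cvg_at_right_filter; exact: strong_solution_continuous.
Qed.

(** Apply the monotonicity criterion to expR (k r) b (e r, e r) with e = x - xb: the differential
    inequality makes its derivative nonpositive almost everywhere, and the modulus of [x] provides
    one for it. *)
Lemma form_nonincreasing (b : X -> X -> R) (C k s t : R) :
  bounded_sym_form b C -> 0 <= C -> 0 <= k -> 0 < s -> s < t ->
  (forall r, s < r -> pdom M (x r) ->
    2 * b (M xb - M (x r)) (x r - xb) <= - k * b (x r - xb) (x r - xb)) ->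
  expR (k * t) * b (x t - xb) (x t - xb) <= expR (k * s) * b (x s - xb) (x s - xb).
Proof.
move=> bP C0 k0 s0 st hb.
(* The solution is considered up to time t + 1, so that [t] is an interior point. *)
have T0 : 0 < t + 1 by rewrite addr_gt0// (lt_trans s0).
have [_ [_ [g gint xg]] xd _ xode] := xsol T0.
have [|h [h0 ih hx]] := weak_derivative_modulus _ xg gint.
  by move=> r; rewrite in_itv/= => /andP[r0 _]; exact: strong_solution_continuous.
pose q r := b (x r - xb) (x r - xb).
have [E0 [E0_ge xE]] : exists E, 0 <= E /\ forall r, s <= r <= t -> `|x r - xb| <= E.
  have c : {within `[s, t], continuous (fun r => `|x r - xb|)}.
    apply/continuous_in_subspaceT => r; rewrite inE/= in_itv/= => /andP[sr _].
    apply: cvg_norm; apply: cvgB; last exact: cvg_cst.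
    exact: (strong_solution_continuous (lt_le_trans s0 sr)).
  have [r0 _ r0P] := EVT_max (ltW st) c.
  by exists `|x r0 - xb|; split => // r rst; apply: r0P; rewrite in_itv.
have qle r : s <= r <= t -> `|q r| <= C * E0 ^+ 2.
  move=> rst; have [_ _ _ b_le] := bP; apply: le_trans (b_le _ _) _.
  by rewrite ler_wpM2l// expr2 ler_pM// xE.
(* By the product rule for increments, [A] multiplies the modulus of [x] (Lipschitz constant of the
   form on the ball of radius [E0]), and [D] accounts for the change of the exponential. *)
pose A := expR (k * t) * (C * (2 * E0)).
pose D := k * expR (k * t) * (C * E0 ^+ 2).
have A0 : 0 <= A by rewrite !mulr_ge0// expR_ge0.
have D0 : 0 <= D by rewrite !mulr_ge0// expR_ge0.
pose h' r := A * h r + D * (\1_(`[s, t]%classic : set R) r).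
have i1 : mu.-integrable setT (EFin \o (\1_(`[s, t]%classic : set R) : R -> R)).
  exact: integrable_indic_itv.
have iA : mu.-integrable setT (EFin \o (fun r => A * h r)).
  by apply: (@integrableZl _ _ _ _ _ _ A) ih.
have iD : mu.-integrable setT (EFin \o (fun r => D * \1_(`[s, t]%classic : set R) r)).
  by apply: (@integrableZl _ _ _ _ _ _ D) i1.
apply: (@ac_nonincreasing _ (fun r => expR (k * r) * q r) h') => //.
- by move=> r; rewrite addr_ge0// mulr_ge0.
- exact: integrableD iA iD.
- move=> r1 r2 sr1 r12 r2t.
  have mr : measurable `[r1, r2] by exact: measurable_itv.
  have -> : \int[mu]_(r in `[r1, r2]) h' r =
      A * \int[mu]_(r in `[r1, r2]) h r + D * (r2 - r1).
    rewrite RintegralD//; last 2 first.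
    - by apply: integrableS iA; [exact: measurableT|exact: mr|].
    - by apply: integrableS iD; [exact: measurableT|exact: mr|].
    rewrite !RintegralZl//; last 2 first.
    - by apply: integrableS i1; [exact: measurableT|exact: mr|].
    - by apply: integrableS ih; [exact: measurableT|exact: mr|].
    congr (_ + D * _); rewrite /Rintegral integral_indic//.
    rewrite (_ : _ `&` _ = `[r1, r2]%classic).
      have := @lebesgue_measure_itv R `[r1, r2]; rewrite /= lte_fin r12 -EFinD => mE.
      by move: mE => /(congr1 fine).
    apply/seteqP; split => u /=; rewrite !in_itv/=; first by case.
    by move=> /andP[u1 u2]; rewrite u1 u2 (le_trans sr1)// (le_trans u2).
  have -> : expR (k * r2) * q r2 - expR (k * r1) * q r1 =
      expR (k * r2) * (q r2 - q r1) + (expR (k * r2) - expR (k * r1)) * q r1 by ring.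
  apply: le_trans (ler_normD _ _) _; apply: lerD; rewrite normrM.
    rewrite ger0_norm ?expR_ge0// /A -mulrA; apply: ler_pM; rewrite ?expR_ge0//.
      by rewrite ler_expR ler_wpM2l.
    apply: le_trans (sym_form_diff_le bP C0 (xE _ _) (xE _ _)) _.
    - by rewrite r2t (le_trans sr1 (ltW r12)).
    - by rewrite sr1 (le_trans (ltW r12)).
    rewrite ler_wpM2l ?mulr_ge0//.
    have -> : x r2 - xb - (x r1 - xb) = x r2 - x r1 by rewrite opprB addrA subrK.
    apply: hx => //; first exact: lt_le_trans sr1.
    by rewrite (le_lt_trans r2t)// ltrDl.
  rewrite /D mulrAC; apply: ler_pM => //.
    apply: le_trans (expR_scale_lipschitz k0 (ltW r12)) _.
    by rewrite ler_wpM2r ?subr_ge0 ?(ltW r12)// ler_wpM2l// ler_expR ler_wpM2l.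
  by apply: qle; rewrite sr1 (le_trans (ltW r12)).
- move: xd xode => [N1 [mN1 N10 dN1]] [N2 [mN2 N20 dN2]].
  exists (N1 `|` N2); split; [exact: measurableU|by rewrite measureU0|].
  move=> r nr; apply: contrapT => nN; apply: nr; rewrite /= in_itv/= => /andP[sr rt].
  have rT : r \in `]0, t + 1[.
    by rewrite in_itv/= (lt_trans s0 sr) (lt_trans rt)// ltrDl.
  have dx : derivable x r 1.
    by apply: contrapT => nd; apply: nN; left; apply: dN1 => /= /(_ rT).
  have [Mr odex] : pdom M (x r) /\ derive1 x r = - M (x r) + B ub.
    by apply: contrapT => nd; apply: nN; right; apply: dN2 => /= /(_ rT).
  have dq : is_derive r (1:R) q (2 * b (derive1 x r) (x r - xb)).
    exact: (is_derive_sym_form bP xb dx).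
  have de : is_derive r (1:R) (fun u : R => expR (k * u)) (expR (k * r) * k).
    apply: (is_derive1_comp (f := expR) (g := fun u => k * u)).
    rewrite -[X in is_derive _ _ _ X]mulr1; exact: (is_deriveZ k (is_derive_id r 1)).
  have dW : is_derive r (1:R) (fun u : R => expR (k * u) * q u)
      (expR (k * r) * (2 * b (derive1 x r) (x r - xb)) + q r * (expR (k * r) * k)).
    exact: is_deriveM.
  split; first exact: ex_derive.
  rewrite derive1E derive_val odex -xbE (addrC (- M (x r))).
  have := hb _ sr Mr; rewrite -/(q r) => hr.
  have : expR (k * r) * (2 * b (M xb - M (x r)) (x r - xb) + k * q r) <= 0.
    by rewrite mulr_ge0_le0 ?expR_ge0//; move: hr; lra.
  lra.
Qed.

(** The initial time, possibly 0, is reached by letting an interior time decrease to [s], using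
    continuity from the right. *)
Lemma form_decay (b : X -> X -> R) (C k s t : R) :
  bounded_sym_form b C -> 0 <= C -> 0 <= k -> 0 <= s -> s <= t ->
  (forall r, s < r -> pdom M (x r) ->
    2 * b (M xb - M (x r)) (x r - xb) <= - k * b (x r - xb) (x r - xb)) ->
  b (x t - xb) (x t - xb) <= expR (- k * (t - s)) * b (x s - xb) (x s - xb).
Proof.
move=> bP C0 k0 s0; rewrite le_eqVlt => /predU1P[<- _|st hb].
  by rewrite subrr mulr0 expR0 mul1r.
have -> : - k * (t - s) = - (k * t) + k * s by ring.
rewrite expRD expRN -mulrA -ler_pdivrMl ?invr_gt0 ?expR_gt0// invrK.
pose W r := expR (k * r) * b (x r - xb) (x r - xb).
have Wc : W r @[r --> s^'+] --> W s.
  apply: cvgM.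
    apply: cvg_at_right_filter; apply: continuous_comp; last exact: continuous_expR.
    by apply: cvgM; [exact: cvg_cst|exact: cvg_id].
  have xs := strong_solution_cvg_right s0.
  by apply: (cvg_sym_form bP); apply: cvgB => //; exact: cvg_cst.
apply: (ler_cvg_to (cvg_cst (W t)) Wc); near=> r.
have sr : s < r by near: r; exact: nbhs_right_gt.
have rt : r < t by near: r; exact: nbhs_right_lt.
apply: (form_nonincreasing bP C0 k0 (le_lt_trans s0 sr) rt) => u ru.
by apply: hb; exact: lt_trans ru.
Unshelve. all: by end_near. Qed.

End form_decay.

(** * Bounded quasi-inverse of a surjective closed operator *)

Section projection.
Variables (R : realType) (H : hilbertType R).
Implicit Types (x y z : H) (G : set H).

Lemma normB_sqr x y : `|x - y| ^+ 2 = `|x| ^+ 2 - 2 * dot x y + `|y| ^+ 2.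
Proof. by rewrite -!dot_norm dotBl !dotBr (dotC y x); ring. Qed.

Lemma normD_sqr x y : `|x + y| ^+ 2 = `|x| ^+ 2 + 2 * dot x y + `|y| ^+ 2.
Proof. by rewrite -!dot_norm dotDl !dotDr (dotC y x); ring. Qed.

(** A minimizing sequence for the distance from [y] to [G] is Cauchy by the parallelogram law, as
    midpoints stay in [G]; its limit attains the distance, and variation along [z] gives
    orthogonality. *)
Lemma orthogonal_decomposition G y : closed G -> G 0 ->
  (forall (a : R) x z, G x -> G z -> G (a *: x + z)) ->
  exists p, G p /\ forall z, G z -> dot (y - p) z = 0.
Proof.
move=> Gc G0 Glin.
pose S := [set `|y - g| ^+ 2 | g in G].
have Slb : lbound S 0 by move=> _ [g _ <-]; exact: sqr_ge0.
have Sinf : has_inf S.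
  by split; [exists (`|y - 0| ^+ 2), 0|exists 0].
have S0 : 0 <= inf S by apply: lb_le_inf => //; case: Sinf.
have Gge g : G g -> inf S <= `|y - g| ^+ 2.
  by move=> Gg; apply: (ge_inf Sinf.2); exists g.
have Gmin n : exists g, G g /\ `|y - g| ^+ 2 < inf S + n.+1%:R^-1.
  have /(inf_adherent)/(_ Sinf)[_ [g Gg <-] h] : 0 < n.+1%:R^-1 :> R by rewrite invr_gt0.
  by exists g.
have [u uP] := choice Gmin.
have para n m : `|u n - u m| ^+ 2 <= 2 * (n.+1%:R^-1 + m.+1%:R^-1).
  have [Gn hn] := uP n; have [Gm hm] := uP m.
  have Gmid : G (2^-1 *: (u n + u m)).
    have := Glin 2^-1 _ _ Gn (Glin 2^-1 _ _ Gm G0).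
    by rewrite addr0 -scalerDr.
  have := Gge _ Gmid.
  have -> : y - 2^-1 *: (u n + u m) = 2^-1 *: ((y - u n) + (y - u m)).
    rewrite addrACA -opprD scalerBr; congr (_ - _).
    by rewrite -mulr2n -[y *+ 2]scaler_nat scalerA mulVf ?scale1r.
  move=> hmid; rewrite normrZ exprMn gtr0_norm ?invr_gt0// normD_sqr in hmid.
  have -> : u n - u m = (y - u m) - (y - u n).
    by rewrite opprB [RHS]addrC subrKA.
  rewrite normB_sqr (dotC (y - u m)).
  have e4 : 2^-1 ^+ 2 = 4^-1 :> R by field.
  rewrite e4 in hmid.
  move: hn hm hmid; move: (n.+1%:R^-1) (m.+1%:R^-1) => p q.
  set A := `|y - u n| ^+ 2; set B := `|y - u m| ^+ 2; set C := dot _ _.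
  lra.
have uc : cauchy (u @ \oo).
  apply/cauchyP => e e0.
  have [N _ /(_ N (leqnn N)) hN] : \forall n \near \oo, n.+1%:R^-1 < (e ^+ 2 / 4) :> R.
    by apply: cvgr_lt; [exact: cvg_harmonic|]; rewrite divr_gt0// exprn_gt0.
  exists (u N); exists N => // n /= Nn; rewrite -ball_normE /=.
  rewrite -ltr_sqr ?nnegrE ?(ltW e0)//; apply: le_lt_trans (para _ _) _.
  have : n.+1%:R^-1 <= N.+1%:R^-1 :> R by rewrite lef_pV2 ?posrE// ler_nat.
  move: hN; move: (e ^+ 2) (n.+1%:R^-1) (N.+1%:R^-1) => E p q.
  lra.
have /cvg_ex[p up] : cvg (u @ \oo) by exact: cauchy_cvg.
have Gp : G p by apply: (closed_cvg G Gc _ _ up); apply: nearW => n; exact: (uP n).1.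
exists p; split => // z Gz.
have yp : `|y - p| ^+ 2 <= inf S.
  have c1 : `|y - u n| ^+ 2 @[n --> \oo] --> `|y - p| ^+ 2.
    rewrite -!dot_norm; under eq_fun do rewrite -dot_norm.
    by apply: cvg_dot; apply: cvgB => //; exact: cvg_cst.
  have c2 : inf S + n.+1%:R^-1 @[n --> \oo] --> inf S + 0.
    by apply: cvgD; [exact: cvg_cst|exact: cvg_harmonic].
  rewrite -[leRHS]addr0; apply: (ler_cvg_to c1 c2); near=> n.
  by apply/ltW; exact: (uP n).2.
have [->|z0] := eqVneq z 0; first by rewrite dot0r.
have nz : 0 < `|z| ^+ 2 by rewrite exprn_gt0// normr_gt0.
(* The optimal step along [z]: it lowers the squared distance by a^2 |z|^2, which minimality forces
   to be 0. *)
pose a := dot (y - p) z / `|z| ^+ 2.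
have := Gge _ (Glin a _ _ Gz Gp).
rewrite opprD addrCA addrC normB_sqr normrZ exprMn dotZr real_normK ?num_real// => h.
have aE : dot (y - p) z = a * `|z| ^+ 2 by rewrite /a divfK// gt_eqF.
rewrite aE in h *.
have {}h : a ^+ 2 * `|z| ^+ 2 <= 0 by move: yp h; lra.
have /eqP : a ^+ 2 == 0.
  by rewrite eq_le sqr_ge0 andbT; rewrite pmulr_lle0 in h.
by move=> /eqP; rewrite sqrf_eq0 => /eqP ->; rewrite mul0r.
Unshelve. all: by end_near. Qed.

End projection.

Section hsum_projections.
Variables (R : realType) (X1 X2 : hilbertType R).
Implicit Types x : hsum X1 X2.

Lemma hsum_norm_sqr x : `|x| ^+ 2 = `|x.1| ^+ 2 + `|x.2| ^+ 2.
Proof. by rewrite -!dot_norm hsum_dotE. Qed.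

Lemma hsum_norm1 x : `|x.1| <= `|x|.
Proof. by rewrite -ler_sqr ?nnegrE// hsum_norm_sqr lerDl sqr_ge0. Qed.

Lemma hsum_norm2 x : `|x.2| <= `|x|.
Proof. by rewrite -ler_sqr ?nnegrE// hsum_norm_sqr lerDr sqr_ge0. Qed.

Lemma cvg_hsum1 x : (fun z : hsum X1 X2 => z.1) @ x --> x.1.
Proof.
apply/(@cvgrPdist_lt _ _ _ (nbhs x)) => e e0; apply/nbhs_ballP; exists e => //= z.
by rewrite -ball_normE /=; exact: (le_lt_trans (hsum_norm1 (x - z))).
Qed.

Lemma cvg_hsum2 x : (fun z : hsum X1 X2 => z.2) @ x --> x.2.
Proof.
apply/(@cvgrPdist_lt _ _ _ (nbhs x)) => e e0; apply/nbhs_ballP; exists e => //= z.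
by rewrite -ball_normE /=; exact: (le_lt_trans (hsum_norm2 (x - z))).
Qed.

End hsum_projections.

(** * Projection onto the graph of a closed operator *)

Section graph_projection.
Variables (R : realType) (X1 X2 : hilbertType R) (A : pop X1 X2).
Hypotheses (Alin : linear_op A) (Acl : closed_op A).

(** [closed_op] refers to the product topology; closedness is pulled back along the continuous
    identity from the Hilbert sum. *)
Lemma closed_graph_hsum :
  closed [set z : hsum X1 X2 | pdom A z.1 /\ A z.1 = z.2].
Proof.
pose j (z : hsum X1 X2) : X1 * X2 := (z.1, z.2).
have jc : continuous j.
  move=> z; apply: (@cvg_pair _ _ _ (nbhs z)).
    exact: cvg_hsum1.
  exact: cvg_hsum2.
by have := closed_comp (fun z _ => jc z) Acl.
Qed.

Lemma linear_opZ (a : R) x : pdom A x -> pdom A (a *: x) /\ A (a *: x) = a *: A x.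
Proof.
move=> Ax; have [A0 Al] := Alin.
have A00 : A 0 = 0.
  have := (Al 1 _ _ A0 A0).2; rewrite !scale1r addr0 => h.
  by apply: (addIr (A 0)); rewrite add0r -h.
by have := Al a _ _ Ax A0; rewrite !addr0 A00 addr0.
Qed.

Lemma adjoint_relE y : pdom (adjoint A) y -> adjoint_rel A y (adjoint A y).
Proof. by move=> h; exact: (@getPex _ (adjoint_rel A y)). Qed.

(* von Neumann: the orthogonal complement of the graph of [A] consists of the
   pairs (- A' q, q), where A' is the adjoint of [A]. *)
Lemma graph_decomposition (x : X1) (y : X2) : exists pq : X1 * X2,
  [/\ pdom A pq.1, y = A pq.1 + pq.2 & adjoint_rel A pq.2 (pq.1 - x)].
Proof.
have [A0 Al] := Alin.
have A00 : A 0 = 0 by have [_] := linear_opZ 0 A0; rewrite !scale0r.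
have [|a u v [u1 u2] [v1 v2]|p [[p1 p2] pO]] :=
  orthogonal_decomposition ((x, y) : hsum X1 X2) closed_graph_hsum.
- by [].
- by have [h1 h2] := Al a _ _ u1 v1; split => //=; rewrite h2 u2 v2.
exists (p.1, y - p.2); split => //=; first by rewrite p2 addrC subrK.
move=> z Az; have := pO (z, A z) (conj Az erefl).
rewrite hsum_dotE /= => /eqP; rewrite dotC (dotC _ (A z)) addr_eq0 => /eqP h.
by rewrite -[LHS]opprK -h -dotNr opprB.
Qed.

(** Subtract the two adjoint relations and test with p - q: |p - q|^2 + |A (p - q)|^2 = 0. *)
Lemma graph_decomposition_uniq (x : X1) (y : X2) p q :
  pdom A p -> adjoint_rel A (y - A p) (p - x) ->
  pdom A q -> adjoint_rel A (y - A q) (q - x) -> p = q.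
Proof.
move=> Ap hp Aq hq; have [A0 Al] := Alin.
have [Apq ApqE] : pdom A (p - q) /\ A (p - q) = A p - A q.
  by have := Al (-1) _ _ Aq Ap; rewrite !scaleN1r addrC (addrC (- A q)).
have h1 := hp _ Apq; have h2 := hq _ Apq.
apply/eqP; rewrite -subr_eq0 -normr_eq0 -sqrf_eq0 -dot_norm.
have {h1 h2} : dot (p - q) (p - q) + dot (A (p - q)) (A (p - q)) = 0.
  have -> : dot (p - q) (p - q) = dot (p - q) (p - x) - dot (p - q) (q - x).
    by rewrite -dotBr opprB addrA subrK.
  rewrite [X in _ + dot _ X]ApqE -h1 -h2 !dotBr; ring.
move=> /eqP; rewrite !dot_norm paddr_eq0 ?sqr_ge0// => /andP[].
by [].
Qed.

(** [N y] is the first component of the projection of (0, y) onto the graph; its linearity follows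
    from uniqueness. *)
Lemma graph_projection : exists N : X2 -> X1, linear N /\
  forall y, pdom A (N y) /\ adjoint_rel A (y - A (N y)) (N y).
Proof.
have [A0 Al] := Alin.
have /choice[N NP] : forall y, exists p, pdom A p /\ adjoint_rel A (y - A p) p.
  move=> y; have [[p q] /= [Ap yE hpq]] := graph_decomposition 0 y.
  by exists p; split => //; rewrite {1}yE addrC addKr -(subr0 p).
exists N; split => // a u v.
have [Nu hu] := NP u; have [Nv hv] := NP v; have [Nw hw] := NP (a *: u + v).
have [Nuv NuvE] := Al a _ _ Nu Nv.
apply: (@graph_decomposition_uniq 0 (a *: u + v)) => //; rewrite subr0//.
move=> z Az; rewrite NuvE opprD addrACA -scalerBr dotDr dotZr hu// hv//.
by rewrite dotDr dotZr.
Qed.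

(** The functionals <q, .> with A' q = z and |z| <= 1 are pointwise bounded: for y = A x, <q, y> =
    <z, x> <= |x|. Uniform boundedness, evaluated at q / |q| after scaling by |z|, gives the
    claim. *)
Lemma adjoint_bounded_below : (forall y, exists2 x, pdom A x & A x = y) ->
  exists2 C, 0 <= C & forall q z, adjoint_rel A q z -> `|q| <= C * `|z|.
Proof.
move=> Asurj.
pose F : set (X2 -> R^o) := [set f | exists q z,
  [/\ adjoint_rel A q z, `|z| <= 1 & f = (fun y => dot q y : R^o)]].
have /(_ _ _ 1)[f [q [z [_ _ ->]]]|y|M FM] := @Banach_Steinhauss R X2 R^o F.
- split.
    move=> r; exists (`|q| * r) => y yr; rewrite (le_trans (dot_abs_le _ _))//.
    by rewrite ler_wpM2l.
  by move=> a u v; rewrite dotDr dotZr.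
- have [x Ax <-] := Asurj y; exists `|x| => _ [q [z [qz z1 ->]]].
  rewrite dotC qz//; apply: le_trans (dot_abs_le _ _) _.
  by rewrite -[leRHS]mulr1 ler_wpM2l.
have M0 : 0 <= M.
  have F0 : F (fun y => dot 0 y).
    by exists 0, 0; split; rewrite ?normr0// => x Ax; rewrite !dot0r.
  by have := FM _ F0 0; rewrite normr0 => /(_ ler01); apply: le_trans.
exists M => // q z qz.
have [q0|q0] := eqVneq q 0; first by rewrite q0 normr0 mulr_ge0.
have [z0|z0] := eqVneq z 0.
  have [x Ax xq] := Asurj q.
  have /eqP := qz x Ax; rewrite xq z0 dot0r dot_norm sqrf_eq0 normr_eq0.
  by rewrite (negbTE q0).
have nz : 0 < `|z| by rewrite normr_gt0.
have nq : 0 < `|q| by rewrite normr_gt0.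
have Fq : F (fun y => dot (`|z|^-1 *: q) y).
  exists (`|z|^-1 *: q), (`|z|^-1 *: z); split => //.
    by move=> x Ax; rewrite !dotZr qz.
  by rewrite normrZ normfV normr_id mulVf ?gt_eqF.
have := FM _ Fq (`|q|^-1 *: q).
rewrite normrZ normfV normr_id mulVf ?gt_eqF// => /(_ (lexx _)).
rewrite dotZl dotZr dot_norm expr2 mulKf ?gt_eqF// => h.
by rewrite mulrC -ler_pdivrMl//; apply: le_trans (ler_norm _) h.
Qed.

(* Writing A' for the adjoint of [A], the witness is N = A' (1 + A A')^-1. *)
Lemma bounded_quasi_inverse : (forall y, exists2 x, pdom A x & A x = y) ->
  exists (N : X2 -> X1) (k : R), 0 < k /\
  [/\ linear N, forall y, pdom A (N y), forall y, `|N y| <= `|y|,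
      forall y, k * `|y| ^+ 2 <= dot (A (N y)) y &
      forall x, pdom A x -> `|N (A x)| <= `|x|].
Proof.
move=> /adjoint_bounded_below[C C0 hC].
have [N [Nlin NP]] := graph_projection.
exists N, (2 * (1 + C ^+ 2))^-1; split.
  by rewrite invr_gt0 mulr_gt0// ltr_pwDl// sqr_ge0.
have key y : dot (A (N y)) y = `|A (N y)| ^+ 2 + `|N y| ^+ 2.
  have [Ny hy] := NP y; have := hy _ Ny; rewrite dotBr -!dot_norm; lra.
split => //.
- by move=> y; exact: (NP y).1.
- move=> y; rewrite -ler_sqr ?nnegrE//.
  have := sqr_ge0 `|y - A (N y)|; have := sqr_ge0 `|A (N y)|.
  have := sqr_ge0 `|N y|; rewrite normB_sqr (dotC y) key; lra.
(* Since y = A N y + q with |q| <= C |N y|, |y|^2 <= 2 (|A N y|^2 + C^2 |N y|^2), at most 2 (1 +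
   C^2) times <A N y, y>. *)
- move=> y; rewrite key mulrC ler_pdivrMr; last by rewrite mulr_gt0// ltr_pwDl// sqr_ge0.
  have := hC _ _ (NP y).2; rewrite -ler_sqr ?nnegrE ?mulr_ge0// exprMn.
  have := sqr_ge0 `|A (N y)|; have := sqr_ge0 `|N y|.
  rewrite normB_sqr (dotC y) key.
  move: (`|y| ^+ 2) (`|A (N y)| ^+ 2) (`|N y| ^+ 2) (C ^+ 2) (sqr_ge0 C) => Y a n c c0.
  nra.
(* Testing with x - N A x gives |A (x - N A x)|^2 = <x, N A x> - |N A x|^2, which is therefore
   nonnegative. *)
- move=> x Ax; have [Nx hx] := NP (A x).
  have [Axp AxpE] : pdom A (x - N (A x)) /\ A (x - N (A x)) = A x - A (N (A x)).
    by have := Alin.2 (-1) _ _ Nx Ax; rewrite !scaleN1r addrC (addrC (- A _)).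
  have := hx _ Axp; rewrite AxpE dot_norm dotBl dot_norm => h.
  have := sqr_ge0 `|A x - A (N (A x))|; rewrite h subr_ge0 => {}h.
  have := le_trans h (dot_CauchySchwarz _ _).
  have := normr_ge0 x; have := normr_ge0 (N (A x)).
  move: (`|N (A x)|) (`|x|) => n m n0 m0; nra.
Qed.

End graph_projection.

(** * Stability of the block operator *)

Lemma op_invP (X : pointedType) (Y : Type) (M : pop X Y) y : invertible M ->
  pdom M (op_inv M y) /\ M (op_inv M y) = y.
Proof.
move=> Minv; split.
  by have [/(_ y I)] := bijpinv_bij (fun=> point) Minv.
have [_ _ Msurj] := Minv.
by have /(_ y) := surjpK (fun=> point) Msurj; apply; rewrite inE.
Qed.

(** Within distance [d] of [a] the derivative gives the constant K + 1; farther away, |f x - f a| <=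
    Q + |f a| is at most (Q + |f a|) / d times |x - a|. *)
Lemma bounded_differentiable_lipschitz (R : realType) (X Y : normedModType R)
    (f : X -> Y) (a : X) (r : R) : bounded_op f -> differentiable f a ->
  exists2 L, 0 < L & forall x, `|x - a| <= r -> `|f x - f a| <= L * `|x - a|.
Proof.
move=> fb df.
have [K K0 hK] := linear_lipschitz (diff_continuous df).
have /eqaddoP/(_ 1 ltr01)/nbhs_ballP[d /= d0 hd] := diff_locally df.
have [Q Q0 hQ] : exists2 Q, 0 < Q & forall x, `|x - a| <= r -> `|f x| <= Q.
  have : bounded_set [set x : X | `|x - a| <= r].
    exists (r + `|a|); split; first exact: num_real.
    move=> M rM x /= xr; rewrite -[x](subrK a) (le_trans (ler_normD _ _))//.
    by apply: ltW; apply: le_lt_trans rM; rewrite lerD2r.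
  move=> /fb/pinfty_ex_gt0[Q Q0 hQ]; exists Q => // x xr.
  by apply: hQ; exists x.
exists (K + 1 + (Q + `|f a|) / d).
  by rewrite addr_gt0// ?addr_gt0// divr_gt0// ltr_wpDr.
have Qd : 0 <= (Q + `|f a|) / d by rewrite divr_ge0 ?addr_ge0 ?(ltW Q0) ?(ltW d0).
move=> x xr; have [xd|xd] := ltP `|x - a| d.
  have := hd (x - a); rewrite -ball_normE /= sub0r normrN => /(_ xd).
  rewrite /= mul1r => hx.
  have h : `|f x - f a - 'd f a (x - a)| <= `|x - a|.
    by rewrite -addrA -opprD -{1}[x](subrK a).
  rewrite -[f x - f a](subrK ('d f a (x - a))) (le_trans (ler_normD _ _))//.
  have := hK (x - a); move: h Qd; have := normr_ge0 (x - a).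
  move: (`|x - a|) (`|'d f a (x - a)|) (`|f x - f a - _|) ((Q + _) / d) => m n p q.
  nra.
apply: (@le_trans _ _ (Q + `|f a|)).
  by rewrite (le_trans (ler_normB _ _))// lerD2r hQ.
have h : Q + `|f a| <= (Q + `|f a|) / d * `|x - a|.
  by rewrite mulrAC ler_pdivlMr// ler_wpM2l// addr_ge0 ?(ltW Q0).
by apply: le_trans h _; rewrite ler_wpM2r// lerDr addr_ge0 ?(ltW K0).
Qed.

Section block_stability.
Variables (R : realType) (X1 X2 U : hilbertType R).
Variables (B : U -> hsum X1 X2) (M1 : X1 -> X1) (M2 : pop X1 X2).
Local Notation M := (block_op M1 M2).
Variables (ub : U) (xb : hsum X1 X2).
Hypotheses (M1b : bounded_op M1) (M2lin : linear_op M2) (M2cl : closed_op M2).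
Hypotheses (Minv : invertible M).
Hypotheses (M1sa : strongly_accretive_at (total_op M1) xb.1).
Hypotheses (M1d : differentiable M1 xb.1).
Hypotheses (xbD : pdom M xb) (xbE : M xb = B ub).

Let M2B x y : pdom M2 x -> pdom M2 y -> pdom M2 (x - y) /\ M2 (x - y) = M2 x - M2 y.
Proof.
by move=> Dx Dy; have := M2lin.2 (-1) _ _ Dy Dx; rewrite !scaleN1r addrC (addrC (- M2 y)).
Qed.

(** Solve M x = (0, y) and read off the second component. *)
Let M2surj y : exists2 x, pdom M2 x & M2 x = y.
Proof.
have [_ _ Msurj] := Minv; have [x [Dx _] [_ xy]] := Msurj (0, y) I.
by exists x.1.
Qed.

Let adjointB x p : pdom M x -> pdom M2 p ->
  dot (adjoint M2 x.2 - adjoint M2 xb.2) p = dot (M2 p) (x.2 - xb.2).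
Proof.
move=> [_ D2] Dp; have [_ Db2] := xbD.
by rewrite dotBr (adjoint_relE D2 Dp) (adjoint_relE Db2 Dp) -dotBr dotC.
Qed.

Let block1 x p : pdom M x -> pdom M2 p ->
  dot (M xb - M x).1 p = dot (M2 p) (x.2 - xb.2) - dot (M1 x.1 - M1 xb.1) p.
Proof. by move=> Dx Dp; rewrite -adjointB//= !dotBl; ring. Qed.

Let block2 x : pdom M x -> (M xb - M x).2 = - M2 (x.1 - xb.1).
Proof.
by move=> [D1 _]; have [_ ->] := M2B D1 xbD.1; rewrite opprB.
Qed.

(* The off-diagonal part of [M] is skew-symmetric. *)
Let block_dissipation x : pdom M x ->
  dot (M xb - M x) (x - xb) = - dot (M1 x.1 - M1 xb.1) (x.1 - xb.1).
Proof.
move=> Dx; have [D _] := M2B Dx.1 xbD.1.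
by rewrite hsum_dotE block1// block2//= dotNl; ring.
Qed.

(** This is decay at rate 0 for the inner product itself. It keeps a solution in the ball for which
    the Lyapunov constants were chosen. *)
Lemma block_norm_decreasing x0 x (s t : R) : strong_solution M B (fun=> ub) x0 x ->
  0 <= s -> s <= t -> `|x t - xb| <= `|x s - xb|.
Proof.
move=> xsol s0 st; rewrite -ler_sqr ?nnegrE// -!dot_norm.
have := form_decay (k := 0) xbE xsol (dot_bounded_sym_form _) ler01 (lexx 0) s0 st.
rewrite oppr0 !mul0r expR0 mul1r; apply=> r sr Dr.
rewrite mul0r pmulr_rle0// block_dissipation// oppr_le0.
have [_ [c c0 hc]] := M1sa; rewrite dotC.
by apply: le_trans (hc _ I); rewrite mulr_ge0 ?sqr_ge0// ltW.
Qed.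

(* [N] plays the role of a bounded inverse of [M2]. *)
Definition lyapunov (N : X2 -> X1) (e : R) (u v : hsum X1 X2) : R :=
  2^-1 * dot u v - e / 2 * (dot u.1 (N v.2) + dot v.1 (N u.2)).

Lemma lyapunov_bounded_sym_form N e : linear N -> (forall y, `|N y| <= `|y|) ->
  0 <= e <= 2^-1 -> bounded_sym_form (lyapunov N e) 1.
Proof.
move=> Nlin Nle /andP[e0 e1].
have ND y z : N (y + z) = N y + N z by have := Nlin 1 y z; rewrite !scale1r.
have N0 : N 0 = 0 by apply: (addIr (N 0)); rewrite -ND !add0r.
have NZ (a : R) y : N (a *: y) = a *: N y by have := Nlin a y 0; rewrite N0 !addr0.
have le2 (u v : hsum X1 X2) : `|dot u.1 (N v.2)| <= `|u| * `|v|.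
  apply: le_trans (dot_abs_le _ _) _; apply: ler_pM => //; first exact: hsum_norm1.
  by apply: le_trans (Nle _) _; exact: hsum_norm2.
split.
- by move=> u v; rewrite /lyapunov (dotC u v) addrC [X in _ * X]addrC addrC.
- by move=> u v w; rewrite /lyapunov /= !dotDl ND dotDr; ring.
- by move=> a u v; rewrite /lyapunov /= !dotZl NZ dotZr; ring.
move=> u v; rewrite mul1r.
have := dot_abs_le u v; have := le2 u v; have := le2 v u.
rewrite [`|v| * `|u|]mulrC /lyapunov !ler_norml.
move: (dot u v) (dot u.1 _) (dot v.1 _) (`|u| * `|v|) => p q r m.
nra.
Qed.

(** The coupling term is at most |u.1| |u.2| / 2 <= |u|^2 / 4 in absolute value, against the main
    term |u|^2 / 2. *)
Lemma lyapunov_coercive N e (u : hsum X1 X2) :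
  (forall y, `|N y| <= `|y|) -> 0 <= e <= 2^-1 ->
  4^-1 * `|u| ^+ 2 <= lyapunov N e u u <= `|u| ^+ 2.
Proof.
move=> Nle /andP[e0 e1]; rewrite /lyapunov dot_norm hsum_norm_sqr.
have : `|dot u.1 (N u.2)| <= `|u.1| * `|u.2|.
  by apply: le_trans (dot_abs_le _ _) _; rewrite ler_wpM2l.
rewrite ler_norml; have := normr_ge0 u.1; have := normr_ge0 u.2.
move: (dot u.1 _) (`|u.1|) (`|u.2|) => d p q q0 p0 /andP[d1 d2].
have : p * q <= (p ^+ 2 + q ^+ 2) / 2 by have := sqr_ge0 (p - q); lra.
have : `|e * d| <= 2^-1 * (p * q).
  by rewrite normrM ger0_norm// ler_pM// ler_norml d1.
rewrite ler_norml => /andP[]; lra.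
Qed.

(* The coupling term supplies the dissipation [- e * dot (M2 (N u.2)) u.2] missing
   in the second component; its other contributions are absorbed by the strong
   accretivity of [M1] for small [e]. *)
Lemma lyapunov_dissipation (r : R) : exists (N : X2 -> X1) (e k : R),
  [/\ linear N, forall y, `|N y| <= `|y|, 0 <= e <= 2^-1, 0 < k &
    forall x, pdom M x -> `|x - xb| <= r ->
      2 * lyapunov N e (M xb - M x) (x - xb) <=
      - k * lyapunov N e (x - xb) (x - xb)].
Proof.
have [N [l [l0 [Nlin ND Nle Nco NM]]]] := bounded_quasi_inverse M2lin M2cl M2surj.
have [L L0 hL] := bounded_differentiable_lipschitz r M1b M1d.
have [_ [c c0 hc]] := M1sa.
(* In [m], the summand L^2 / (2 l) comes from Young's inequality for the [M1] term and 1 from <u1, N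
   M2 u1> <= |u1|^2. The choice of [e] gives e m <= c / 2, so half of the dissipation c |u1|^2 and
   of e l |u2|^2 survives; [k] is the smaller of the two remaining rates. *)
pose m := 1 + L ^+ 2 / (2 * l).
have m0 : 0 < m by rewrite addr_gt0// divr_gt0 ?exprn_gt0// mulr_gt0.
pose e := c / (2 * m + 2 * c).
have d0 : 0 < 2 * m + 2 * c by rewrite addr_gt0// mulr_gt0.
have e0 : 0 < e by rewrite divr_gt0.
have e2 : e <= 2^-1 by rewrite ler_pdivrMr//; move: m0; lra.
have em : e * m <= c / 2.
  by rewrite mulrAC ler_pdivrMr//; have := mulr_gt0 c0 c0; lra.
pose k := Num.min (c / 2) (e * l / 2).
have k0 : 0 < k by rewrite lt_min !divr_gt0// mulr_gt0.
exists N, e, k; split => //; first by rewrite (ltW e0).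
move=> x Dx xr; have [D _] := M2B Dx.1 xbD.1.
have eb : 0 <= e <= 2^-1 by rewrite (ltW e0).
have /andP[_ Vle] := lyapunov_coercive (x - xb) Nle eb.
apply: (@le_trans _ _ (- k * `|x - xb| ^+ 2)); last first.
  by rewrite !mulNr lerN2 ler_wpM2l// ltW.
rewrite /lyapunov block_dissipation// block1// block2//.
have N0 : N 0 = 0.
  by have := Nlin (-1) 0 0; rewrite scaler0 addr0 scaleN1r addNr.
have NN y : N (- y) = - N y.
  by have := Nlin (-1) y 0; rewrite N0 !addr0 !scaleN1r.
rewrite NN dotNr hsum_norm_sqr /=.
set u1 := x.1 - xb.1; set u2 := x.2 - xb.2; set D1 := M1 x.1 - M1 xb.1.
have hx1 : `|u1| <= r by apply: le_trans xr; exact: (hsum_norm1 (x - xb)).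
have i1 : c * `|u1| ^+ 2 <= dot D1 u1 by rewrite dotC; exact: hc.
have i2 : `|dot D1 (N u2)| <= L * (`|u1| * `|u2|).
  apply: le_trans (dot_abs_le _ _) _; rewrite mulrA ler_pM//.
  exact: hL.
have i3 : l * `|u2| ^+ 2 <= dot (M2 (N u2)) u2 by exact: Nco.
have i4 : dot u1 (N (M2 u1)) <= `|u1| ^+ 2.
  by apply: le_trans (dot_CauchySchwarz _ _) _; rewrite expr2 ler_wpM2l// NM.
have kc : k <= c / 2 by rewrite ge_min lexx.
have kl : k <= e * l / 2 by rewrite ge_min lexx orbT.
have young : L * (`|u1| * `|u2|) <= l / 2 * `|u2| ^+ 2 + (m - 1) * `|u1| ^+ 2.
  have -> : m - 1 = L ^+ 2 / (2 * l) by rewrite /m; ring.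
  rewrite -(ler_pM2l (_ : 0 < 2 * l)) ?mulr_gt0//.
  have -> : 2 * l * (l / 2 * `|u2| ^+ 2 + L ^+ 2 / (2 * l) * `|u1| ^+ 2) =
      l ^+ 2 * `|u2| ^+ 2 + L ^+ 2 * `|u1| ^+ 2 by field; rewrite gt_eqF.
  by have := sqr_ge0 (L * `|u1| - l * `|u2|); lra.
move: i1 i2 i3 i4 young; have := sqr_ge0 `|u1|; have := sqr_ge0 `|u2|.
move: (dot D1 u1) (dot D1 (N u2)) (dot (M2 (N u2)) u2) (dot u1 (N (M2 u1))).
move: (L * _) (`|u1| ^+ 2) (`|u2| ^+ 2) => g p q A F E G q0 p0 i1 i2 i3 i4 young.
have f1 : e * (l * q) <= e * E by rewrite ler_wpM2l// ltW.
have f2 : e * F <= e * (l / 2 * q + (m - 1) * p).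
  rewrite ler_wpM2l ?(ltW e0)//; apply: le_trans young.
  by apply: le_trans (ler_norm _) i2.
have f3 : e * G <= e * p by rewrite ler_wpM2l// ltW.
have f4 : e * m * p <= c / 2 * p by rewrite ler_wpM2r.
have f5 : k * p <= c / 2 * p by rewrite ler_wpM2r.
have f6 : k * q <= e * l / 2 * q by rewrite ler_wpM2r.
lra.
Qed.

(** As |e|^2 / 4 <= V <= |e|^2, decay of V at rate k gives decay of the norm at rate k / 2 with
    factor 2. *)
Lemma block_local_decay (r : R) : exists2 k, 0 < k &
  forall x0 x, strong_solution M B (fun=> ub) x0 x ->
  forall s t, 0 <= s -> s <= t -> `|x s - xb| <= r ->
    `|x t - xb| <= 2 * `|x s - xb| * expR (- k * (t - s)).
Proof.
have [N [e [k [Nlin Nle eb k0 hk]]]] := lyapunov_dissipation r.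
exists (k / 2); first by rewrite divr_gt0.
move=> x0 x xsol s t s0 st xs.
have bP := lyapunov_bounded_sym_form Nlin Nle eb.
have hV : forall u, s < u -> pdom M (x u) ->
    2 * lyapunov N e (M xb - M (x u)) (x u - xb) <=
    - k * lyapunov N e (x u - xb) (x u - xb).
  move=> u su Du; apply: hk => //.
  exact: le_trans (block_norm_decreasing xsol s0 (ltW su)) xs.
have := form_decay xbE xsol bP ler01 (ltW k0) s0 st hV.
have /andP[+ _] := lyapunov_coercive (x t - xb) Nle eb.
have /andP[_ +] := lyapunov_coercive (x s - xb) Nle eb.
move: (lyapunov _ _ _ _) (lyapunov _ _ _ _) => V W sW Vt VW.
rewrite -ler_sqr ?nnegrE ?mulr_ge0 ?expR_ge0// !exprMn.
have -> : expR (- (k / 2) * (t - s)) ^+ 2 = expR (- k * (t - s)).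
  by rewrite expr2 -expRD; congr expR; field.
have : expR (- k * (t - s)) * W <= expR (- k * (t - s)) * `|x s - xb| ^+ 2.
  by rewrite ler_wpM2l ?expR_ge0.
lra.
Qed.

(** Up to time [T r] the norm does not increase, and [alpha] absorbs the missing decay; from then on
    the error is at most 1 and decays at the rate [k 1], independent of the initial value. *)
Lemma block_exp_decay : exists c alpha,
  [/\ 0 < c, (forall r, 0 < alpha r) &
    forall x0 x, strong_solution M B (fun=> ub) x0 x ->
    forall t, 0 <= t -> `|x t - xb| <= alpha `|x0| * expR (- c * t)].
Proof.
have /choice[k kP] : forall r, exists k, 0 < k /\
  forall x0 x, strong_solution M B (fun=> ub) x0 x ->
  forall s t, 0 <= s -> s <= t -> `|x s - xb| <= r ->
    `|x t - xb| <= 2 * `|x s - xb| * expR (- k * (t - s)).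
  by move=> r; have [k k0 hk] := block_local_decay r; exists k.
pose c := k 1; pose rho (r : R) := `|r| + `|xb| + 1.
(* With rho bounding the initial error, k T = 2 rho and 2 rho <= expR (2 rho), so the error at time
   T is at most 1. *)
pose T r := 2 * rho r / k (rho r).
have c0 : 0 < c by exact: (kP 1).1.
have rho1 r : 1 <= rho r by rewrite lerDr addr_ge0.
have rho0 r : 0 < rho r by exact: lt_le_trans (rho1 r).
have T0 r : 0 <= T r by rewrite ltW// divr_gt0 ?mulr_gt0//; exact: (kP _).1.
pose alpha r := 2 * rho r * expR (c * T r).
exists c, alpha; split => //; first by move=> r; rewrite !mulr_gt0// expR_gt0.
move=> x0 x xsol t t0.
have x0E : x 0 = x0 by have [_ _ _ -> _] := xsol 1 ltr01.
set r := `|x0|.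
have xrho : `|x 0 - xb| <= rho r.
  rewrite x0E (le_trans (ler_normB _ _))// /rho /r normr_id -addrA lerD2l lerDl.
  exact: ler01.
have -> : alpha r * expR (- c * t) = 2 * rho r * expR (- c * (t - T r)).
  by rewrite /alpha -mulrA -expRD; congr (_ * expR _); ring.
have [tT|tT] := leP t (T r).
  apply: (@le_trans _ _ (2 * rho r * 1)); last first.
    rewrite ler_wpM2l//; first by rewrite mulr_ge0// ltW.
    by rewrite -expR0 ler_expR mulNr oppr_ge0 mulr_ge0_le0 ?(ltW c0)// subr_le0.
  apply: le_trans (block_norm_decreasing xsol (lexx 0) t0) _.
  by apply: le_trans xrho _; have := rho0 r; lra.
have x1 : `|x (T r) - xb| <= 1.
  have [k0 hk] := kP (rho r).
  apply: le_trans (hk _ _ xsol _ _ (lexx 0) (T0 r) xrho) _.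
  rewrite subr0 mulNr expRN ler_pdivrMr ?expR_gt0// mul1r.
  apply: le_trans (expR_ge1Dx _).
  have -> : k (rho r) * T r = 2 * rho r by rewrite /T mulrC divfK ?gt_eqF.
  by move: xrho; lra.
have [_ hk] := kP 1.
apply: le_trans (hk _ _ xsol _ _ (T0 r) (ltW tT) x1) _.
rewrite ler_wpM2r ?expR_ge0// ler_pM2l// (le_trans x1)//.
Qed.

End block_stability.

Theorem proposition2p5 (R : realType) (X1 X2 U : hilbertType R)
    (B : {linear U -> hsum X1 X2}) (M1 : X1 -> X1) (M2 : pop X1 X2)
    (xbar1 : X1) :
  let M := block_op M1 M2 in
  bounded_op B ->
  bounded_op M1 -> m_accretive (total_op M1) ->
  linear_op M2 -> closed_op M2 -> densely_defined M2 ->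
  m_accretive M -> invertible M ->
  strongly_accretive_at (total_op M1) xbar1 ->
  (forall x1, differentiable M1 x1) ->
  (forall ubar : U,
      (exists! xbar, steady_state M B ubar xbar) /\
      steady_state M B ubar (op_inv M (B ubar))) /\
  (forall ubar : U, let xbar := op_inv M (B ubar) in
    xbar.1 = xbar1 ->
    [/\ (exists delta c alpha,
          [/\ 0 < delta, 0 < c, (forall r, 0 < alpha r)
            & exp_decay M B ubar xbar delta c alpha]),
        (forall x0, pdom M x0 ->
          forall x, strong_solution M B (fun=> ubar) x0 x ->
          x t @[t --> +oo] --> xbar)
      & (linear M1 ->
          exists c alpha,
          [/\ 0 < c, (forall r, 0 < alpha r)
            & forall delta, 0 < delta ->
              exp_decay M B ubar xbar delta c alpha])]).
Proof.
move=> M _ M1b _ M2lin M2cl _ _ Minv M1sa M1d; split=> ubar.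
  have [xD xE] := op_invP (B ubar) Minv.
  have ss : steady_state M B ubar (op_inv M (B ubar)) by split; rewrite // xE addNr.
  split => //; exists (op_inv M (B ubar)); split => // y [yD /eqP].
  rewrite addrC subr_eq0 => /eqP yE; have [_ Minj _] := Minv.
  by apply: Minj; rewrite ?inE// xE.
move=> xbar xbar1E; have [xD xE] := op_invP (B ubar) Minv.
rewrite -xbar1E in M1sa.
have [c [alpha [c0 alpha0 decay]]] :=
  block_exp_decay M1b M2lin M2cl Minv M1sa (M1d _) xD xE.
split.
- by exists 1, c, alpha; split => // x0 _ _; exact: decay.
- move=> x0 _ x xsol; apply/cvgrPdist_le => e e0.
  pose a := alpha `|x0|; have a0 : 0 < a by exact: alpha0.
  near=> t; rewrite distrC.
  have t0 : 0 < t by near: t; exact: nbhs_pinfty_gt.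
  apply: le_trans (decay _ _ xsol _ (ltW t0)) _; rewrite -/a.
  (* By 1 + u <= expR u with u = c t, it suffices that t >= a / (e c). *)
  rewrite mulNr expRN ler_pdivrMr ?expR_gt0// -ler_pdivrMl//.
  apply: le_trans (expR_ge1Dx _).
  have : e^-1 * a / c <= t by near: t; apply: nbhs_pinfty_ge; exact: num_real.
  rewrite ler_pdivrMr// mulrC; lra.
- by move=> _; exists c, alpha; split => // delta _ x0 _ _; exact: decay.
Unshelve. all: by end_near. Qed.
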